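(* Let $n$ be a positive integer and $f$ a rooted forest of degree $n$ (with attached rooted forest map $f$). Let $\phi_fR_x:\mathfrak{H}\to\mathfrak{H}$ be the linear map sending $w$ to the unique $v\in\mathfrak{H}$ with $vy=f(wx)-f(w)x$. Then: (A) the restriction of $\varphi\tau\,(\phi_fR_x)\,\tau\varphi$ to $\mathfrak{H}^1$ belongs to $\mathfrak{W}'_n$; (B) $\chi_x^{-1}f\chi_x=-\lambda(\varphi\tau\,(\phi_fR_x)\,\tau\varphi)$ on $\mathfrak{H}^1$, and in particular $\chi_x^{-1}f\chi_x\in\mathfrak{W}_n$.
   Context: Rooted forests, $\deg$ (number of vertices), the algebra $H$ of rooted forests, $B_+$ and the coproduct $\Delta$ are as follows: rooted trees are finite non-planar rooted trees, forests are finite multisets of them ($\mathbb{I}$ empty); $B_+(t_1\cdots t_n)$ adds a new root joined to the roots of the $t_i$, $B_+(\mathbb{I})=\bullet$; $\Delta$ is the algebra homomorphism with $\Delta(\mathbb{I})=\mathbb{I}\otimes\mathbb{I}$, $\Delta(B_+(f))=B_+(f)\otimes\mathbb{I}+(\mathrm{id}\otimes B_+)\Delta(f)$. $\mathfrak{H}=\mathbb{Q}\langle x,y\rangle$, $z=x+y$, $R_u(w)=wu$, $L_u(w)=uw$, $R_y^{-1}$ the inverse of $R_y$ on $\mathfrak{H}y$, $M(v\otimes w)=vw$. Rooted forest maps: to each forest $f$ a $\mathbb{Q}$-linear $f:\mathfrak{H}\to\mathfrak{H}$ (identity for $\mathbb{I}$) with $\bullet(x)=xy$, $\bullet(y)=-xy$;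 for nonempty $f$, $u\in\{x,y\}$: $f(u)\in\mathfrak{H}y$, $B_+(f)(u)=R_yR_{y+z}R_y^{-1}f(u)$; $(gh)(u)=g(h(u))$ for $g,h\ne\mathbb{I}$; $f(wu)=M(\Delta(f)(w\otimes u))$ for $w\in\mathfrak{H}$, where $\Delta(f)(v\otimes w)=\sum a(v)\otimes b(w)$ for $\Delta(f)=\sum a\otimes b$. (Such maps exist, $f(wx)-f(w)x\in\mathfrak{H}y$ for all $w$, and nonempty forest maps send $\mathfrak{H}y$ into $\mathfrak{H}y$.) $\mathfrak{H}^1=\mathbb{Q}+\mathfrak{H}y$; $\mathfrak{H}^1_n$ is its homogeneous part of degree $n$ ($x,y$ of degree 1). $z_k=x^{k-1}y$ ($k\ge1$). The harmonic product $*$ is the $\mathbb{Q}$-bilinear product on $\mathfrak{H}^1$ with $1*w=w*1=w$ and $z_kw*z_lw'=z_k(w*z_lw')+z_l(z_kw*w')+z_{k+l}(w*w')$. For $w\in\mathfrak{H}^1$, $\mathcal{H}_w:\mathfrak{H}^1\to\mathfrak{H}^1$, $\mathcal{H}_w(v)=w*v$. $\mathfrak{W}$ (resp. $\mathfrak{W}_n$) is the $\mathbb{Q}$-span of $\{\mathcal{H}_w: w\in\mathfrak{H}^1\}$ (resp. $w\in\mathfrak{H}^1_n$); $\mathfrak{W}'$ is the span of $\{L_{z_k}\mathcal{H}_w: k\ge1, w\in\mathfrak{H}^1\}$ and $\mathfrak{W}'_n$ the span of $\{L_{z_k}\mathcal{H}_w: 1\le k\le n, w\in\mathfrak{H}^1_{n-k}\}$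 (operators on $\mathfrak{H}^1$). The operators $L_{z_k}\mathcal{H}_w$ ($k\ge1$, $w$ a word of $\mathfrak{H}^1$) are linearly independent, and $\lambda:\mathfrak{W}'\to\mathfrak{W}$ is the linear map with $\lambda(L_{z_k}\mathcal{H}_w)=\mathcal{H}_{z_kw}$. $\varphi$ is the algebra automorphism of $\mathfrak{H}$ with $\varphi(x)=x+y$, $\varphi(y)=-y$; $\tau$ is the anti-automorphism with $\tau(x)=y$, $\tau(y)=x$; $\chi_x=\tau L_x\varphi$, and $\chi_x^{-1}=\varphi\tau R_y^{-1}$ on $\mathfrak{H}y$. *)

(* Defs.v *)
From HB Require Import structures.
From mathcomp Require Import all_boot all_order all_algebra finmap.
From mathcomp.multinomials Require Import monalg.

Set Implicit Arguments.
Unset Strict Implicit.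
Unset Printing Implicit Defensive.

Import GRing.Theory.
Local Open Scope ring_scope.

(* The linear extension of h : K -> V to the free vector space on K. *)
HB.lock Definition linext (K : choiceType) (V : lmodType rat) (h : K -> V)
    (g : {malg rat[K]}) : V :=
  \sum_(k <- msupp g) g@_k *: h k.

Section LinExt.
Context (K : choiceType) (V : lmodType rat) (h : K -> V).
Local Notation linext := (linext h).

Lemma linextEw (d : {fset K}) g : fsubset (msupp g) d ->
  linext g = \sum_(k <- d) g@_k *: h k.
Proof.
move=> le; rewrite unlock [LHS](big_fset_incl _ le) //= => k kd /mcoeff_outdom ->.
by rewrite scale0r.
Qed.

Lemma linextU c k : linext << c *g k >> = c *: h k.
Proof. by rewrite (linextEw msuppU_le) big_seq_fset1 mcoeffUU. Qed.

Lemma linext_is_linear : linear linext.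
Proof.
move=> c g1 g2; pose d := fsetU (msupp g1) (msupp g2).
have le1 : fsubset (msupp g1) d by apply: fsubsetUl.
have le2 : fsubset (msupp g2) d by apply: fsubsetUr.
have le3 : fsubset (msupp (c *: g1 + g2)) d.
  apply: fsubset_trans (msuppD_le _ _) _; apply: fsetUSS => //.
  exact: msuppZ_le.
rewrite (linextEw le1) (linextEw le2) (linextEw le3) scaler_sumr -big_split /=.
by apply: eq_bigr => k _; rewrite mcoeffD mcoeffZ scalerDl scalerA.
Qed.

HB.instance Definition _ :=
  GRing.isLinear.Build rat {malg rat[K]} V *:%R linext linext_is_linear.

End LinExt.

Lemma eq_linext (K : choiceType) (V : lmodType rat) (h1 h2 : K -> V) :
  h1 =1 h2 -> linext h1 =1 linext h2.
Proof. by move=> e g; rewrite unlock; apply: eq_bigr => k _; rewrite e. Qed.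

Lemma linextP (K : choiceType) (V : lmodType rat) (h1 h2 : K -> V) a g :
  linext (fun k => a *: h1 k + h2 k) g = a *: linext h1 g + linext h2 g.
Proof.
rewrite unlock scaler_sumr -big_split; apply: eq_bigr => k _ /=.
by rewrite scalerDr !scalerA mulrC.
Qed.

Lemma linext_comp (K : choiceType) (V U : lmodType rat) (f : {linear V -> U})
  (h : K -> V) g : f (linext h g) = linext (fun k => f (h k)) g.
Proof.
by rewrite unlock linear_sum; apply: eq_bigr => k _; rewrite linearZ.
Qed.

Lemma malg_span (K : choiceType) (g : {malg rat[K]}) :
  g = \sum_(k <- msupp g) g@_k *: << k >>.
Proof.
rewrite {1}[g]monalgE; apply: eq_bigr => k _.
by apply/malgP => k'; rewrite mcoeffZ !mcoeffU mulr_natr.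
Qed.

Lemma malgUM (K : monomType) (k l : K) :
  << k >> * << l >> = << (mmul k l) >> :> {malg rat[K]}.
Proof. by rewrite [LHS]fgmulUU mulr1. Qed.

Lemma malgC_comm (K : monomType) (a : rat) (b : {malg rat[K]}) :
  b * a%:MP = a%:MP * b.
Proof.
rewrite mul_malgC [LHS]fgmulgU [RHS]malgZ_def /fgscale.
by apply: eq_bigr => k _; rewrite mulm1 mulrC.
Qed.

Lemma malg_scaleAr (K : monomType) (a : rat) (b c : {malg rat[K]}) :
  a *: (b * c) = b * (a *: c).
Proof. by rewrite -!mul_malgC mulrA -malgC_comm -mulrA. Qed.

Lemma malgZU (K : choiceType) (c : rat) (k : K) :
  c *: << k >> = << c *g k >> :> {malg rat[K]}.
Proof. by apply/malgP => k'; rewrite mcoeffZ !mcoeffU mulr_natr. Qed.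

Lemma malg_ind (K : choiceType) (P : {malg rat[K]} -> Prop) :
  P 0 -> (forall c k g, P g -> P (c *: << k >> + g)) -> forall g, P g.
Proof.
move=> P0 PD g; rewrite (malg_span g).
elim: (enum_fset (msupp g)) => [|k l IH]; first by rewrite big_nil.
by rewrite big_cons; apply: PD.
Qed.

Lemma linext_mul (K L : monomType) (h : K -> {malg rat[L]}) :
    (forall k l, h (mmul k l) = h k * h l) ->
  {morph linext h : g1 g2 / g1 * g2}.
Proof.
move=> hM; apply: malg_ind => [|c k g IH] g2.
  by rewrite mul0r linear0 mul0r.
rewrite mulrDl !linearD /= mulrDl IH; congr (_ + _).
rewrite -scalerAl !linearZ /= -scalerAl; congr (_ *: _).
rewrite linextU scale1r; move: g2; apply: malg_ind => [|d l g2 IH2].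
  by rewrite mulr0 linear0 mulr0.
rewrite mulrDr !linearD /= mulrDr IH2; congr (_ + _).
rewrite -malg_scaleAr malgUM !linearZ /= -malg_scaleAr.
by rewrite !linextU !scale1r hM.
Qed.

(* The letters are encoded by booleans: x is false and y is true. *)
Notation HH := {malg rat[{fmonom bool}]}.

Definition word (s : seq bool) : HH := << FMonom s >>.

Definition letter (u : bool) : HH := word [:: u].
Notation X := (letter false).
Notation Y := (letter true).
Notation Z := (X + Y).

Definition phi : HH -> HH :=
  linext (fun w : {fmonom bool} => \prod_(u <- w) (if u then - Y else X + Y)).

Definition tau : HH -> HH :=
  linext (fun w : {fmonom bool} => word (rev (map negb w))).

(* The inverse of right multiplication by y, extended by 0 to the words that
   do not end with y. *)
Definition Ry_inv : HH -> HH :=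
  linext (fun w : {fmonom bool} =>
    if last false w then word (take (size w).-1 w) else 0).

Definition chi (w : HH) : HH := tau (X * phi w).
Definition chi_inv (w : HH) : HH := phi (tau (Ry_inv w)).

Definition HHy : {pred HH} :=
  fun w : HH => all (fun m : {fmonom bool} => last false m) (msupp w).

HB.instance Definition _ := GRing.Linear.on phi.
HB.instance Definition _ := GRing.Linear.on tau.
HB.instance Definition _ := GRing.Linear.on Ry_inv.

Lemma phi0 : phi 0 = 0. Proof. exact: linear0. Qed.
Lemma phiD : {morph phi : v w / v + w}. Proof. exact: linearD. Qed.
Lemma phiZ a : {morph phi : v / a *: v}. Proof. exact: linearZ. Qed.
Lemma tau0 : tau 0 = 0. Proof. exact: linear0. Qed.
Lemma tauD : {morph tau : v w / v + w}. Proof. exact: linearD. Qed.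
Lemma tauZ a : {morph tau : v / a *: v}. Proof. exact: linearZ. Qed.

Lemma fmonomM (s t : seq bool) :
  mmul (FMonom s) (FMonom t) = FMonom (s ++ t).
Proof. exact: fmmulE. Qed.

Lemma wordM s t : word s * word t = word (s ++ t).
Proof. by rewrite /word malgUM fmonomM. Qed.

Lemma word0 : word [::] = 1.
Proof. by rewrite /word -fmoneE. Qed.

Lemma word_cat s : word s = \prod_(u <- s) letter u.
Proof.
by elim: s => [|u s IH]; rewrite ?big_nil ?word0 // big_cons -IH wordM.
Qed.

Lemma HH_ind (P : HH -> Prop) :
  P 0 -> (forall c s w, P w -> P (c *: word s + w)) -> forall w, P w.
Proof. by move=> P0 PD; apply: malg_ind => // c [s]; apply: PD. Qed.

Lemma phi_word s : phi (word s) = \prod_(u <- s) (if u then - Y else X + Y).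
Proof. by rewrite /phi linextU scale1r. Qed.

Lemma tau_word s : tau (word s) = word (rev (map negb s)).
Proof. by rewrite /tau linextU scale1r. Qed.

Lemma Ry_invK w : Ry_inv (w * Y) = w.
Proof.
move: w; apply: HH_ind => [|c s w IH]; first by rewrite mul0r linear0.
rewrite mulrDl -scalerAl wordM linearP /= IH /Ry_inv linextU scale1r /=.
by rewrite cats1 last_rcons size_rcons -cats1 take_size_cat.
Qed.

Lemma phiM : {morph phi : v w / v * w}.
Proof.
by apply: linext_mul => k l; rewrite -big_cat fmM.
Qed.

Lemma phi1 : phi 1 = 1.
Proof. by rewrite -[in LHS]word0 phi_word big_nil. Qed.

Lemma tauM v w : tau (v * w) = tau w * tau v.
Proof.
move: v w; apply: HH_ind => [|c s v IH] w; first by rewrite mul0r tau0 mulr0.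
rewrite mulrDl !tauD mulrDr; apply: congr2; last exact: IH.
rewrite -scalerAl !tauZ -malg_scaleAr; congr (_ *: _).
move: w; apply: HH_ind => [|d t w IHw]; first by rewrite mulr0 tau0 mul0r.
rewrite mulrDr !tauD mulrDl; apply: congr2; last exact: IHw.
rewrite -malg_scaleAr.
rewrite !tauZ -scalerAl; congr (_ *: _).
by rewrite wordM !tau_word wordM -rev_cat -map_cat.
Qed.

Lemma tauK : involutive tau.
Proof.
apply: HH_ind => [|c s w IH]; first by rewrite !tau0.
rewrite !(tauD, tauZ); apply: congr2; last exact: IH.
rewrite !tau_word map_rev revK mapK //; exact: negbK.
Qed.

Lemma phiK : involutive phi.
Proof.
apply: HH_ind => [|c s w IH]; first by rewrite !phi0.
rewrite !(phiD, phiZ); apply: congr2; last exact: IH.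
rewrite word_cat; congr (_ *: _).
elim: s => [|u s IHs]; first by rewrite big_nil !phi1.
rewrite big_cons !phiM IHs; congr (_ * _).
have pX : phi X = X + Y by rewrite phi_word big_seq1.
have pY : phi Y = - Y by rewrite phi_word big_seq1.
have pYY : phi (- Y) = Y by rewrite -scaleN1r phiZ pY scaleN1r opprK.
by case: u; rewrite ?pX ?pY ?pYY // phiD pX pY addrK.
Qed.

Lemma chiK : cancel chi chi_inv.
Proof.
move=> w; rewrite /chi /chi_inv tauM tau_word.
by rewrite (_ : word _ = Y) // Ry_invK tauK phiK.
Qed.

Lemma HHyP (w : HH) : reflect (exists v, w = v * Y) (w \in HHy).
Proof.
apply: (iffP allP) => [wy|[v ->] m /msuppM_le [a [b [_]]]]; last first.
  rewrite msuppU1 inE => /eqP -> ->.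
  by rewrite fmM last_cat.
exists (\sum_(m <- msupp w)
  w@_m *: word (take (size (m : seq bool)).-1 (m : seq bool))).
rewrite {1}(malg_span w) mulr_suml big_seq [RHS]big_seq.
apply: eq_bigr => -[s] /wy sy; rewrite -scalerAl wordM; congr (_ *: _).
rewrite /word; congr << FMonom _ >>; rewrite /= in sy *.
case/lastP: s sy => [//|s u]; rewrite last_rcons => ->.
by rewrite size_rcons -cats1 take_size_cat.
Qed.

(* Planar rooted trees: a root and the sequence of its branches. *)
Inductive ptree : predArgType := PNode of seq ptree.

Fixpoint ptree_code (t : ptree) : GenTree.tree nat :=
  let: PNode ts := t in GenTree.Node 0 (map ptree_code ts).

Fixpoint ptree_decode (g : GenTree.tree nat) : option ptree :=
  if g is GenTree.Node _ gs then Some (PNode (pmap ptree_decode gs)) else None.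

Fixpoint ptree_all_ind (P : ptree -> Prop)
    (IH : forall ts, foldr (fun t Q => P t /\ Q) True ts -> P (PNode ts))
    (t : ptree) : P t :=
  let: PNode ts := t in
  IH ts ((fix all_P s : foldr (fun t Q => P t /\ Q) True s :=
    match s with
    | [::] => I
    | t' :: s' => conj (ptree_all_ind IH t') (all_P s')
    end) ts).

Lemma ptree_codeK : pcancel ptree_code ptree_decode.
Proof.
elim/ptree_all_ind => ts IH /=; congr (Some (PNode _)).
by elim: ts IH => //= t ts IHs [-> /IHs ->].
Qed.

HB.instance Definition _ := Countable.copy ptree (pcan_type ptree_codeK).

(* A (non-planar) rooted tree is represented by its planar embedding in which
   the branches at each vertex are sorted for a fixed total order on ptree. *)
Definition ptree_le (s t : ptree) : bool := (choice.pickle s <= choice.pickle t)%N.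

Fixpoint sorted_ptree (t : ptree) : bool :=
  let: PNode ts := t in sorted ptree_le ts && all sorted_ptree ts.

Record tree : predArgType := Tree { ptree_of : ptree; _ : sorted_ptree ptree_of }.
HB.instance Definition _ := [isSub for ptree_of].
HB.instance Definition _ := [Countable of tree by <:].

(* Forests are finite multisets of trees, the product being disjoint union. *)
Notation forest := {cmonom tree}.

Definition trees (f : forest) : seq tree :=
  flatten [seq nseq (f t) t | t <- finsupp f].

Lemma Bplus_sorted (f : forest) :
  sorted_ptree (PNode (sort ptree_le (map ptree_of (trees f)))).
Proof.
rewrite /= sort_sorted /=; last by move=> s t; apply: leq_total.
by rewrite all_sort all_map; apply/allP => -[t].
Qed.

Definition Bplus (f : forest) : tree := Tree (Bplus_sorted f).

Notation bullet := (Bplus mone).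

Fixpoint pdeg (t : ptree) : nat := let: PNode ts := t in (sumn (map pdeg ts)).+1.

Definition deg (f : forest) : nat := (\sum_(t <- trees f) pdeg (ptree_of t))%N.

Lemma ptree_le_total : total ptree_le.
Proof. by move=> s t; apply: leq_total. Qed.

Lemma ptree_le_trans : transitive ptree_le.
Proof. by move=> s t u; apply: leq_trans. Qed.

Lemma ptree_le_anti : antisymmetric ptree_le.
Proof. by move=> s t; rewrite /ptree_le -eqn_leq => /eqP; apply: pcan_inj; apply: choice.pickleK. Qed.

Lemma count_trees f t : count_mem t (trees f) = f t.
Proof.
rewrite /trees count_flatten -map_comp sumnE big_map.
have [tf|tf] := boolP (t \in finsupp f); last first.
  rewrite fsfun_dflt // big_seq big1 // => s sf /=.
  rewrite count_nseq /=; case: eqP => [e|_]; last by rewrite mul0n.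
  by rewrite e (negPf tf) in sf.
rewrite (big_fsetD1 t) //= count_nseq /= eqxx mul1n big_seq big1 ?addn0 // => s.
by rewrite !inE => /andP[st _]; rewrite count_nseq /= (negPf st) mul0n.
Qed.

Lemma trees1 : trees mone = [::].
Proof. by rewrite /trees mdom1. Qed.

Lemma treesM f g : perm_eq (trees (mmul f g)) (trees f ++ trees g).
Proof.
by apply/allP => t _ /=; rewrite count_cat !count_trees cmM eqxx.
Qed.

Lemma treesU t : trees (ucm t) = [:: t].
Proof.
apply: perm_small_eq => //; apply/allP => s _ /=.
by rewrite count_trees cmU addn0.
Qed.

Lemma trees_perm f g : perm_eq (trees f) (trees g) -> f = g.
Proof.
move=> /permP fg; apply/eqP/cmP => t.
by rewrite -!count_trees fg.
Qed.

Lemma trees_prod f : \big[mmul/mone]_(t <- trees f) ucm t = f.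
Proof.
apply: trees_perm; elim: (trees f) => [|t ts IH].
  by rewrite big_nil trees1.
by rewrite big_cons; apply: perm_trans (treesM _ _) _; rewrite treesU perm_cons.
Qed.

Lemma Bplus_inj : injective Bplus.
Proof.
move=> f g /(congr1 ptree_of) [] e; apply: trees_perm.
apply: (perm_map_inj val_inj); rewrite -(perm_sort ptree_le) /= e.
by rewrite perm_sort.
Qed.

(* Forgets the planar embedding. *)
Fixpoint tree_of (t : ptree) : tree :=
  let: PNode ts := t in
  Bplus (foldr (fun s f => mmul (ucm (tree_of s)) f) mone ts).

Lemma perm_trees_of ts :
  perm_eq (trees (foldr (fun s f => mmul (ucm (tree_of s)) f) mone ts))
    (map tree_of ts).
Proof.
elim: ts => [|t ts IH] /=; first by rewrite trees1.
by apply: perm_trans (treesM _ _) _; rewrite treesU /= perm_cons.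
Qed.

Lemma ptree_ofK : cancel ptree_of tree_of.
Proof.
case=> t st; apply: val_inj => /=; move: t st.
elim/ptree_all_ind => ts IH /= /andP[sts ats]; congr PNode.
have e : map (ptree_of \o tree_of) ts = ts.
  elim: ts ats IH {sts} => //= t ts IHts /andP[st /IHts {}IHts] [IHt /IHts ->].
  by rewrite IHt.
rewrite -[RHS](sorted_sort ptree_le_trans sts).
apply/(perm_sortP ptree_le_total ptree_le_trans ptree_le_anti).
by rewrite -[X in perm_eq _ X]e map_comp perm_map // perm_trees_of.
Qed.

Lemma Bplus_surj (t : tree) : exists f, t = Bplus f.
Proof. by rewrite -[t]ptree_ofK; case: (ptree_of t) => ts; eexists. Qed.

Section MonomProd.
Context (K L : conomType).
Local Notation KL := (K * L)%type.

Definition mprod_one : KL := (mone, mone).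
Definition mprod_mul (p q : KL) : KL := (mmul p.1 q.1, mmul p.2 q.2).

Fact mprod_mulA : associative mprod_mul.
Proof. by move=> p q r; rewrite /mprod_mul /= !mulmA. Qed.
Fact mprod_mul1 : left_id mprod_one mprod_mul.
Proof. by case=> a b; rewrite /mprod_mul /= !mul1m. Qed.
Fact mprod_mulr1 : right_id mprod_one mprod_mul.
Proof. by case=> a b; rewrite /mprod_mul /= !mulm1. Qed.
Fact mprod_unit p q : mprod_mul p q = mprod_one -> p = mprod_one /\ q = mprod_one.
Proof. by case: p q => [a b] [c d] [/unitm[/= -> ->] /unitm[/= -> ->]]. Qed.
Fact mprod_mulC : commutative mprod_mul.
Proof. by move=> p q; congr pair; apply: mulmC. Qed.

HB.instance Definition _ := Choice_isMonomialDef.Build KL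
  mprod_mulA mprod_mul1 mprod_mulr1 mprod_unit.
HB.instance Definition _ := MonomialDef_isConomialDef.Build KL mprod_mulC.

End MonomProd.

(* The algebra of rooted forests, with basis the forests, and its tensor
   square, with basis the pairs (a, b), standing for a (x) b. *)
Notation HF := {malg rat[forest]}.
Notation HF2 := {malg rat[(forest * forest)%type]}.

Definition id_Bplus : HF2 -> HF2 :=
  linext (fun p : (forest * forest)%type => << (p.1, ucm (Bplus p.2)) >> : HF2).
HB.instance Definition _ := GRing.Linear.on id_Bplus.

Fixpoint coprod_ptree (t : ptree) : HF2 :=
  let: PNode ts := t in
  << (ucm (tree_of t), mone) >> +
  id_Bplus (foldr (fun s D => coprod_ptree s * D) 1 ts).

Definition coprod_tree (t : tree) : HF2 := coprod_ptree (ptree_of t).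

Definition coprod : HF -> HF2 :=
  linext (fun f : forest => \prod_(t <- trees f) coprod_tree t).
HB.instance Definition _ := GRing.Linear.on coprod.

Lemma coprodU (f : forest) :
  coprod << f >> = \prod_(t <- trees f) coprod_tree t.
Proof. by rewrite /coprod linextU scale1r. Qed.

Lemma coprod1 : coprod 1 = 1.
Proof. by rewrite [LHS]coprodU trees1 big_nil. Qed.

Lemma coprodM : {morph coprod : a b / a * b}.
Proof.
apply: linext_mul => f g; rewrite -big_cat; apply: perm_big; exact: treesM.
Qed.

Lemma coprod_ptreeE ts :
  coprod_ptree (PNode ts) = << (ucm (tree_of (PNode ts)), mone) >> +
    id_Bplus (\prod_(s <- ts) coprod_ptree s).
Proof.
have <- : foldr (fun s D => coprod_ptree s * D) 1 ts =
  \prod_(s <- ts) coprod_ptree s; last by [].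
by elim: ts => [|t ts IH]; rewrite ?big_nil // big_cons -IH.
Qed.

(* Delta (B_+ f) = B_+ f (x) 1 + (id (x) B_+) (Delta f) *)
Lemma coprod_Bplus (f : forest) :
  coprod << ucm (Bplus f) >> =
  << (ucm (Bplus f), mone) >> + id_Bplus (coprod << f >>).
Proof.
apply: etrans (coprodU (ucm (Bplus f))) _.
rewrite treesU big_seq1.
have e : coprod_tree (Bplus f) = << (ucm (Bplus f), mone) >> +
    id_Bplus (\prod_(s <- sort ptree_le (map ptree_of (trees f))) coprod_ptree s).
  by rewrite -{2}[Bplus f]ptree_ofK; apply: coprod_ptreeE.
apply: etrans e _; apply: congr2; first by [].
apply: (congr1 id_Bplus); apply: etrans _ (esym (coprodU f)).
by rewrite (perm_big _ (permEl (perm_sort ptree_le _))) big_map.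
Qed.

(* H^1 = Q + H y: the words that are empty or end with y, which is what
   last true says. *)
Definition HH1_pred : {pred HH} :=
  fun w : HH => all (fun m : {fmonom bool} => last true m) (msupp w).

Lemma HH1_predP (w : HH) :
  reflect (exists (c : rat) (v : HH), w = c *: 1 + v * Y) (w \in HH1_pred).
Proof.
apply: (iffP allP) => [wP|[c [v ->]] m mP].
  have wy : w - w@_mone *: 1 \in HHy.
    apply/allP => m; have := wP m; rewrite -!mcoeff_neq0 mcoeffB mcoeffZ mcoeff1.
    have [->|m1] := eqVneq m mone; first by rewrite mulr1 subrr eqxx.
    rewrite mulr0 subr0 => {}wP /wP; case: m m1 {wP} => -[|u s] //=.
    by rewrite -fmoneE eqxx.
  have /HHyP[v e] := wy; exists w@_mone, v.
  by rewrite -e addrC subrK.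
have := fsubsetP (msuppD_le _ _) _ mP; rewrite inE => /orP[].
  move/(fsubsetP (msuppZ_le _ _)); rewrite msuppU1 inE => /eqP ->.
  by rewrite fm1.
case/msuppM_le => a [b [_]]; rewrite msuppU1 inE => /eqP -> ->.
by rewrite fmM last_cat.
Qed.

Fact HH1_subalg : subalg_closed HH1_pred.
Proof.
split=> [|a v w /allP vP /allP wP|v w /allP vP /allP wP].
- by apply/HH1_predP; exists 1, 0; rewrite mul0r addr0 scale1r.
- apply/allP => m /(fsubsetP (msuppD_le _ _)).
  by rewrite inE => /orP[/(fsubsetP (msuppZ_le _ _))/vP|/wP].
apply/allP => m /msuppM_le [a [b [/vP la /wP lb ->]]].
by rewrite fmM last_cat la.
Qed.

HB.instance Definition _ := GRing.isSubalgClosed.Build rat HH HH1_pred HH1_subalg.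

Record HH1 : predArgType := MkHH1 { HH1_val : HH; _ : HH1_val \in HH1_pred }.
HB.instance Definition _ := [isSub for HH1_val].
HB.instance Definition _ := [Choice of HH1 by <:].
HB.instance Definition _ := [SubChoice_isSubLalgebra of HH1 by <:].

Fact zword_subproof (k : nat) : X ^+ k.-1 * Y \in HH1_pred.
Proof.
by apply/HH1_predP; exists 0, (X ^+ k.-1); rewrite scale0r add0r.
Qed.

(* z_k = x^(k-1) y for k >= 1 (z_0 is never used). *)
Definition z (k : nat) : HH1 := MkHH1 (zword_subproof k).

Definition zprod (s : seq nat) : HH1 := \prod_(k <- s) z k.

Fixpoint stuffle (s t : seq nat) : HH1 :=
  match s with
  | [::] => zprod t
  | k :: s' =>
    (fix stuffle_s t := match t with
      | [::] => zprod s
      | l :: t' => z k * stuffle s' t + z l * stuffle_s t'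
                   + z (k + l) * stuffle s' t'
      end) t
  end.

(* The indices k_1, k_2, ... of a word z_(k_1) z_(k_2) ... of H^1; the
   argument i counts the letters x read since the last y. *)
Fixpoint zindex_from (i : nat) (w : seq bool) : seq nat :=
  match w with
  | [::] => [::]
  | false :: w' => zindex_from i.+1 w'
  | true :: w' => i.+1 :: zindex_from 0 w'
  end.
Definition zindex : seq bool -> seq nat := zindex_from 0.

Definition harm (v w : HH1) : HH1 :=
  linext (fun a : {fmonom bool} =>
    linext (fun b : {fmonom bool} => stuffle (zindex a) (zindex b)) (val w))
    (val v).

Lemma stuffles0 s : stuffle s [::] = zprod s.
Proof. by case: s. Qed.

Lemma harmDl (a : rat) v1 v2 w :
  harm (a *: v1 + v2) w = a *: harm v1 w + harm v2 w.
Proof. by rewrite /harm !linearP. Qed.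

Lemma harmDr (a : rat) v w1 w2 :
  harm v (a *: w1 + w2) = a *: harm v w1 + harm v w2.
Proof.
by rewrite /harm -linextP; apply: eq_linext => m; apply: linearP.
Qed.

Definition zword (s : seq nat) : seq bool :=
  flatten [seq rcons (nseq k.-1 false) true | k <- s].

Lemma val_z k : val (z k) = word (rcons (nseq k.-1 false) true).
Proof.
rewrite /= -cats1 -wordM; congr (_ * _).
elim: k.-1 => [|n IH]; first by rewrite expr0 word0.
by rewrite exprS IH wordM.
Qed.

Lemma val_zprod s : val (zprod s) = word (zword s).
Proof.
elim: s => [|k s IH]; first by rewrite /zprod big_nil word0 rmorph1.
have -> : zprod (k :: s) = z k * zprod s by rewrite /zprod big_cons.
by rewrite [LHS]rmorphM [X in _ * X]IH [X in X * _]val_z wordM.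
Qed.

Lemma zindex_from_pos i w : all (leq 1) (zindex_from i w).
Proof. by elim: w i => [|[] w IH] i //=; apply: IH. Qed.

Lemma zwordK s : all (leq 1) s -> zindex (zword s) = s.
Proof.
have e i n t : zindex_from i (rcons (nseq n false) true ++ t) =
    (i + n).+1 :: zindex t.
  by elim: n i => [|n IH] i /=; rewrite ?addn0 // IH addSnnS.
elim: s => [//|[//|k] s IH] /= sP; rewrite /zindex /zword /= e add0n.
by congr (_ :: _); apply: IH.
Qed.

Lemma zindexK w : last true w -> zword (zindex w) = w.
Proof.
have e i : last true (nseq i false ++ w) ->
    zword (zindex_from i w) = nseq i false ++ w.
  elim: w i => [|[] w IH] i.
  - rewrite cats0; case: i => // i; have: last true (nseq i.+1 false) = false.
      by rewrite /=; elim: i.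
    by move=> ->.
  - rewrite last_cat /= => wP; rewrite /zword /= cat_rcons.
    by congr (_ ++ _ :: _); apply: (IH 0%N).
  - have -> : nseq i false ++ false :: w = nseq i.+1 false ++ w.
      by elim: i {IH} => //= i ->.
    exact: IH.
exact: (e 0%N).
Qed.

Lemma HH1_ind (P : HH1 -> Prop) : P 0 ->
    (forall c s w, all (leq 1) s -> P w -> P (c *: zprod s + w)) ->
  forall w, P w.
Proof.
move=> P0 PD w.
have -> : w = \sum_(m <- msupp (val w)) (val w)@_m *: zprod (zindex m).
  apply: val_inj; rewrite raddf_sum {1}(malg_span (val w)) big_seq [RHS]big_seq.
  apply: eq_bigr => -[m] mw.
  transitivity ((val w)@_(FMonom m) *: val (zprod (zindex m))); last by [].
  rewrite val_zprod zindexK //.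
  by have /allP/(_ _ mw) := valP w.
elim: (enum_fset _) => [|m s IH]; first by rewrite big_nil.
by rewrite big_cons; apply: PD IH; apply: zindex_from_pos.
Qed.

Lemma HH1_linear_eq (F G : HH1 -> HH1) : linear F -> linear G ->
  (forall s, all (leq 1) s -> F (zprod s) = G (zprod s)) -> F =1 G.
Proof.
move=> FP GP e.
have z0 H : linear H -> H 0 = 0 :> HH1.
  by move=> HP; have := HP (-1) 0 0; rewrite scaler0 addr0 scaleN1r addNr.
apply: HH1_ind => [|c s w sP IH]; first by rewrite !z0.
by rewrite FP GP e //; congr (_ + _).
Qed.

Lemma harm_zprod s t : all (leq 1) s -> all (leq 1) t ->
  harm (zprod s) (zprod t) = stuffle s t.
Proof.
move=> sP tP; rewrite /harm !val_zprod /word linextU scale1r linextU scale1r /=.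
by rewrite !zwordK.
Qed.

Lemma harm0l w : harm 0 w = 0. Proof. by rewrite /harm linear0. Qed.
Lemma harm0r v : harm v 0 = 0.
Proof. by have := harmDr 1 v 0 0; rewrite !scale1r addr0 => /eqP; rewrite -subr_eq subrr eq_sym => /eqP. Qed.

Lemma harm1l w : harm 1 w = w.
Proof.
move: w; apply: HH1_ind => [|c s w sP IH]; first exact: harm0r.
rewrite harmDr IH (_ : 1 = zprod [::]) ?harm_zprod //.
by rewrite /zprod big_nil.
Qed.

Lemma harm1r w : harm w 1 = w.
Proof.
move: w; apply: HH1_ind => [|c s w sP IH]; first exact: harm0l.
rewrite harmDl IH (_ : 1 = zprod [::]) ?harm_zprod ?stuffles0 //.
by rewrite /zprod big_nil.
Qed.

Lemma HH1_scaleAr (a : rat) (v w : HH1) : v * (a *: w) = a *: (v * w).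
Proof. by apply: val_inj; rewrite /= -malg_scaleAr. Qed.

Lemma harm_zz k l (v w : HH1) : (1 <= k)%N -> (1 <= l)%N ->
  harm (z k * v) (z l * w) =
    z k * harm v (z l * w) + z l * harm (z k * v) w + z (k + l) * harm v w.
Proof.
move=> k1 l1.
have D3 (a : rat) (A B C A' B' C' : HH1) :
    (a *: A + A') + (a *: B + B') + (a *: C + C') =
    a *: (A + B + C) + (A' + B' + C').
  by rewrite ![in RHS]scalerDr (addrACA (a *: A)) [LHS]addrACA.
move: v; apply: HH1_linear_eq => [a v1 v2|a v1 v2|s sP].
- by rewrite mulrDr HH1_scaleAr harmDl.
- by rewrite !mulrDr !HH1_scaleAr !harmDl !mulrDr !HH1_scaleAr D3.
move: w; apply: HH1_linear_eq => [a w1 w2|a w1 w2|t tP].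
- by rewrite mulrDr HH1_scaleAr harmDr.
- by rewrite !mulrDr !HH1_scaleAr !harmDr !mulrDr !HH1_scaleAr D3.
have zE m u : z m * zprod u = zprod (m :: u) by rewrite /zprod big_cons.
by rewrite !zE !harm_zprod //= ?k1 ?l1 ?sP ?tP.
Qed.

(* M (D (v (x) w)) for D in HF2, where a forest acts through Phi. *)
Definition coact (Phi : forest -> {linear HH -> HH}) (D : HF2) (v w : HH) : HH :=
  linext (fun p : (forest * forest)%type => Phi p.1 v * Phi p.2 w) D.

(* The axioms of rooted forest maps; they determine Phi. *)
Record is_forest_maps (Phi : forest -> {linear HH -> HH}) : Prop := ForestMaps {
  forest_map1 : forall w, Phi mone w = w;
  forest_map_bullet_x : Phi (ucm bullet) X = X * Y;
  forest_map_bullet_y : Phi (ucm bullet) Y = - (X * Y);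
  forest_map_letter : forall f u, f != mone -> Phi f (letter u) \in HHy;
  forest_map_Bplus : forall f u, f != mone ->
    Phi (ucm (Bplus f)) (letter u) = Ry_inv (Phi f (letter u)) * (Y + Z) * Y;
  forest_map_mul : forall g h u, g != mone -> h != mone ->
    Phi (mmul g h) (letter u) = Phi g (Phi h (letter u));
  forest_map_coprod : forall f w u,
    Phi f (w * letter u) = coact Phi (coprod << f >>) w (letter u)
}.

(* phi_f R_x; see phi_RxP for the equation that characterizes it. *)
Definition phi_Rx (f : HH -> HH) (w : HH) : HH := Ry_inv (f (w * X) - f w * X).

Lemma HHyD v w : v \in HHy -> w \in HHy -> v + w \in HHy.
Proof.
by move=> /HHyP[a ->] /HHyP[b ->]; apply/HHyP; exists (a + b); rewrite mulrDl.
Qed.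

Lemma HHyZ a v : v \in HHy -> a *: v \in HHy.
Proof. by case/HHyP => b ->; apply/HHyP; exists (a *: b); rewrite scalerAl. Qed.

Lemma HHyM v w : w \in HHy -> v * w \in HHy.
Proof. by case/HHyP => b ->; apply/HHyP; exists (v * b); rewrite mulrA. Qed.

Lemma HHy0 : 0 \in HHy.
Proof. by apply/HHyP; exists 0; rewrite mul0r. Qed.

Lemma HHy_linext (K : choiceType) (h : K -> HH) g :
  (forall k, h k \in HHy) -> linext h g \in HHy.
Proof.
move=> hP; rewrite unlock; elim: (enum_fset _) => [|k s IH].
  by rewrite big_nil HHy0.
by rewrite big_cons HHyD ?HHyZ.
Qed.

Lemma HHy_Ry_inv w : w \in HHy -> Ry_inv w * Y = w.
Proof. by case/HHyP => v ->; rewrite Ry_invK. Qed.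

Lemma forest_map_HHy Phi f w : is_forest_maps Phi -> w \in HHy -> Phi f w \in HHy.
Proof.
move=> PhiP /HHyP[v ->]; rewrite forest_map_coprod //.
apply: HHy_linext => -[a b] /=; apply: HHyM.
have [->|b1] := eqVneq b mone; last exact: forest_map_letter.
by rewrite forest_map1 //; apply/HHyP; exists 1; rewrite mul1r.
Qed.

(* id (x) epsilon, for the counit epsilon. *)
Definition id_counit : HF2 -> HF := linext
  (fun p : (forest * forest)%type => if p.2 == mone then << p.1 >> : HF else 0).

HB.instance Definition _ := GRing.Linear.on id_counit.

Lemma id_counitU p :
  id_counit << p >> = if p.2 == mone then << p.1 >> else 0.
Proof. by rewrite /id_counit linextU scale1r. Qed.

Lemma id_counitM : {morph id_counit : D E / D * E}.
Proof.
apply: linext_mul => -[a b] [c d] /=; rewrite cmM_eq1.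
case: eqP => _ /=; last by rewrite mul0r.
case: eqP => _; last by rewrite mulr0.
by rewrite malgUM.
Qed.

Lemma id_counit_Bplus D : id_counit (id_Bplus D) = 0.
Proof.
rewrite [LHS]linext_comp unlock big1 // => p _.
by rewrite [X in _ *: X]id_counitU cm1_eq1 scaler0.
Qed.

Lemma coprod_counit f : id_counit (coprod << f >>) = << f >>.
Proof.
have e t : id_counit (coprod_tree t) = << ucm t >>.
  have [g ->] := Bplus_surj t.
  have -> : coprod_tree (Bplus g) = << (ucm (Bplus g), mone) >> +
      id_Bplus (coprod << g >>).
    apply: etrans _ (coprod_Bplus g); apply: etrans _ (esym (coprodU _)).
    by rewrite treesU big_seq1.
  apply: etrans (linearD _ _ _) _.
  rewrite [X in _ + X]id_counit_Bplus addr0.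
  by apply: etrans (id_counitU _) _; rewrite eqxx.
rewrite coprodU -[in RHS](trees_prod f).
elim: (trees f) => [|t ts IH].
  by rewrite !big_nil; apply: etrans (id_counitU _) _; rewrite eqxx.
rewrite !big_cons; apply: etrans (id_counitM _ _) _.
by apply: etrans (congr2 _ (e t) IH) _; apply: malgUM.
Qed.

Lemma phi_RxP Phi f w : is_forest_maps Phi ->
  phi_Rx (Phi f) w * Y = Phi f (w * X) - Phi f w * X.
Proof.
move=> PhiP; apply: HHy_Ry_inv; rewrite forest_map_coprod // /coact.
have -> : Phi f w = linext (fun p : (forest * forest)%type =>
    if p.2 == mone then Phi p.1 w else 0) (coprod << f >>).
  transitivity (linext (fun a => Phi a w) (id_counit (coprod << f >>))).
    by rewrite coprod_counit linextU scale1r.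
  rewrite [LHS]linext_comp; apply: eq_linext => p; case: eqP => _.
    by apply: etrans (linextU _ _ _) _; rewrite scale1r.
  exact: linear0.
have -> g D : linext g D * X =
    linext (fun p : (forest * forest)%type => g p * X) D.
  by rewrite unlock mulr_suml; apply: eq_bigr => p _; rewrite scalerAl.
rewrite addrC -scaleN1r -linextP; apply: HHy_linext => -[a b] /=.
case: eqVneq => [->|b1].
  by rewrite (forest_map1 PhiP) scaleN1r addNr HHy0.
by rewrite mul0r scaler0 add0r HHyM ?(forest_map_letter PhiP).
Qed.

Notation op := (HH1 -> HH1).

Definition Hop (w : HH1) : op := fun v => harm w v.
Definition LHop (k : nat) (w : HH1) : op := fun v => z k * Hop w v.

Definition opspan (S : op -> Prop) (A : op) : Prop :=
  exists (m : nat) (c : 'I_m -> rat) (B : 'I_m -> op),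
    (forall i, S (B i)) /\ A =1 (fun v => \sum_(i < m) c i *: B i v).

Definition homog (n : nat) (w : HH1) : Prop :=
  forall m : {fmonom bool}, m \in msupp (val w) -> size m = n.

Definition W : op -> Prop := opspan (fun B => exists w, B = Hop w).
Definition W_ (n : nat) : op -> Prop :=
  opspan (fun B => exists2 w, homog n w & B = Hop w).
Definition W' : op -> Prop :=
  opspan (fun B => exists k w, (1 <= k)%N /\ B = LHop k w).
Definition W'_ (n : nat) : op -> Prop :=
  opspan (fun B => exists k w,
    [/\ (1 <= k <= n)%N, homog (n - k) w & B = LHop k w]).

(* lambda : W' -> W; its values outside W' are irrelevant. *)
Record is_lambda (lambda : op -> op) : Prop := IsLambda {
  lambdaP : forall (a : rat) A B, W' A -> W' B ->
    lambda (fun v => a *: A v + B v) =1 (fun v => a *: lambda A v + lambda B v);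
  lambda_LHop : forall k (w : HH1) s, (1 <= k)%N -> val w = word s ->
    lambda (LHop k w) =1 Hop (z k * w)
}.

Lemma lambda_exists : exists lambda, is_lambda lambda.
Proof.
exists (fun A => Hop (A 1)); split=> [a A B _ _ v|k w s _ _ v] /=.
  by rewrite /Hop harmDl.
by rewrite /LHop /Hop harm1r.
Qed.

(* The linear map T on H maps H^1 to itself and A is its restriction to H^1. *)
Definition restricts (T : HH -> HH) (A : op) : Prop :=
  forall v : HH1, val (A v) = T (val v).

(* Main.v *)
(* Write psi = phi tau, an anti-automorphism of H with psi x = -y, psi y = z and
   psi z = x.  For a forest f put f' = psi f psi^-1 and let A_f be the operator
   of (A).  Since f kills z, f' is determined by f' 1 = 0, f' x = x f' and
   f' y = y f' - z A_f (x, y, z standing for left multiplications), and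
   chi_x^-1 f chi_x = f' - A_f.  Moreover A_(B+ f) = (x + z) A_f - y f', while
   the compatibility of forest maps with the coproduct gives (gh)' = g' h' and
   hence A_(gh) = A_g h' + (g' - A_g) A_h.

   For w = sum_i c_i z_(k_i) w_i in H y let N_w = sum_i c_i L_(z_(k_i)) H_(w_i),
   so that lambda N_w = H_w.  The recursion for the harmonic product says that
   D = H_w - N_w satisfies D 1 = 0, D x = x D and D y = y D + z N_w.  So if
   A_f = -N_w on H^1, then f' = H_w - N_w and chi_x^-1 f chi_x = H_w there.
   That A_f = -N_w for some w of degree deg f follows by induction on f: w = y
   for the one-vertex tree, w_(B+ f) = (2x + y) w_f and w_(gh) = w_g * w_h, the
   last one by associativity of the harmonic product. *)

From HB Require Import structures.
Require Import Defs.
From mathcomp Require Import all_boot all_order all_algebra finmap.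
From mathcomp.multinomials Require Import monalg.
From Stdlib Require Import FunctionalExtensionality.

Set Implicit Arguments.
Unset Strict Implicit.
Unset Printing Implicit Defensive.

Import GRing.Theory.
Local Open Scope ring_scope.

(** * Linear extension from a basis *)

Lemma linextD (K : choiceType) (V : lmodType rat) (h : K -> V) g1 g2 :
  linext h (g1 + g2) = linext h g1 + linext h g2.
Proof. exact: linearD. Qed.

Lemma linextU1 (K : choiceType) (V : lmodType rat) (h : K -> V) k :
  linext h << k >> = h k.
Proof. by rewrite linextU scale1r. Qed.

Lemma eq_linext_in (K : choiceType) (V : lmodType rat) (h1 h2 : K -> V) g :
  {in msupp g, h1 =1 h2} -> linext h1 g = linext h2 g.
Proof.
move=> e; rewrite unlock big_seq [RHS]big_seq.
by apply: eq_bigr => k kg; rewrite e.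
Qed.

Lemma linext_mulr (K : choiceType) (h : K -> HH) g v :
  linext h g * v = linext (fun k => h k * v) g.
Proof.
by rewrite unlock mulr_suml; apply: eq_bigr => k _; rewrite scalerAl.
Qed.

Lemma linext_mull (K : choiceType) (h : K -> HH) g v :
  v * linext h g = linext (fun k => v * h k) g.
Proof.
by rewrite unlock mulr_sumr; apply: eq_bigr => k _; rewrite -malg_scaleAr.
Qed.

Lemma linext_prod (K : monomType) (V : lmodType rat) (h : K -> V)
    (g1 g2 : {malg rat[K]}) :
  linext h (g1 * g2) =
    linext (fun k => linext (fun l => h (mmul k l)) g2) g1.
Proof.
move: g1; apply: malg_ind => [|c k g1 IH]; first by rewrite mul0r !linear0.
rewrite mulrDl -scalerAl !linext_is_linear IH; congr (_ *: _ + _).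
rewrite linextU scale1r; move: g2 {IH}; apply: malg_ind => [|d l g2 IH].
  by rewrite mulr0 !linear0.
by rewrite mulrDr -malg_scaleAr malgUM !linext_is_linear IH !linextU !scale1r.
Qed.

(** * Rooted forests and their coproduct *)

Lemma degM f g : deg (mmul f g) = (deg f + deg g)%N.
Proof. by rewrite /deg (perm_big _ (treesM f g)) big_cat. Qed.

Lemma deg1 : deg mone = 0%N.
Proof. by rewrite /deg trees1 big_nil. Qed.

Lemma deg_Bplus f : deg (ucm (Bplus f)) = (deg f).+1.
Proof.
rewrite /deg treesU big_seq1 /= sumnE big_map.
by rewrite (perm_big _ (permEl (perm_sort _ _))) big_map.
Qed.

(** Trees are reached through their planar representatives, whose structural induction supplies the
    hypothesis for every branch. *)
Lemma forest_ind (P : forest -> Prop) : P mone ->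
    (forall f, P f -> P (ucm (Bplus f))) ->
    (forall f g, P f -> P g -> P (mmul f g)) ->
  forall f, P f.
Proof.
move=> P1 PB PM.
have PT t : P (ucm (tree_of t)).
  elim/ptree_all_ind: t => ts IH /=; apply: PB.
  by elim: ts IH => //= t ts IHts [Pt /IHts]; apply: PM.
move=> f; rewrite -(trees_prod f); elim: (trees f) => [|t ts IH].
  by rewrite big_nil.
by rewrite big_cons; apply: PM => //; rewrite -[t]ptree_ofK.
Qed.

Lemma deg_eq0 f : (deg f == 0%N) = (f == mone).
Proof.
elim/forest_ind: f => [|f _|f g IHf IHg]; first by rewrite deg1 !eqxx.
  by rewrite deg_Bplus cm1_eq1.
by rewrite degM addn_eq0 IHf IHg cmM_eq1.
Qed.

(** The case distinction for inductions on the degree: in the third case both factors have smaller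
    degree than [f]. *)
Lemma forestP f : [\/ f = mone, exists g, f = ucm (Bplus g) |
  exists g h, [/\ g != mone, h != mone & f = mmul g h]].
Proof.
elim/forest_ind: f => [|f _|f g].
- by constructor 1.
- by constructor 2; exists f.
have [->|f1] := eqVneq f mone; first by rewrite mul1m.
have [->|g1] := eqVneq g mone; first by rewrite mulm1.
by move=> _ _; constructor 3; exists f, g.
Qed.

Lemma coprod_mul f g :
  coprod << mmul f g >> = coprod << f >> * coprod << g >>.
Proof. by rewrite -coprodM; congr coprod; rewrite malgUM. Qed.

Lemma msupp_linext_le (K L : choiceType) (h : K -> {malg rat[L]}) g l :
  l \in msupp (linext h g) -> exists2 k, k \in msupp g & l \in msupp (h k).
Proof.
rewrite unlock => lP.
have [/hasP[k kg lk]|/hasPn e] := boolP (has (fun k =>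
  l \in msupp (h k)) (msupp g)).
  by exists k.
case/idPn: lP; rewrite -mcoeff_eq0 raddf_sum big_seq big1 //= => k /e.
by rewrite -mcoeff_eq0 mcoeffZ => /eqP ->; rewrite mulr0.
Qed.

Lemma coprod_one : coprod << mone >> = << (mone, mone) >>.
Proof. exact: coprod1. Qed.

(** The coproduct is graded; this bounds the degrees of the forests met in the later inductions. *)
Lemma coprod_deg f (p : (forest * forest)%type) :
  p \in msupp (coprod << f >>) -> (deg p.1 + deg p.2)%N = deg f.
Proof.
elim/forest_ind: f p => [|f IH|f g IHf IHg] p.
- rewrite coprod_one => /(fsubsetP msuppU_le); rewrite inE => /eqP ->.
  by rewrite /= deg1.
- rewrite coprod_Bplus => /(fsubsetP (msuppD_le _ _)); rewrite inE => /orP[].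
    by move/(fsubsetP msuppU_le); rewrite inE => /eqP -> /=; rewrite deg1 addn0.
  case/msupp_linext_le => q /IH; rewrite deg_Bplus => <-.
  by move/(fsubsetP msuppU_le); rewrite inE => /eqP -> /=;
    rewrite deg_Bplus addnS.
rewrite coprod_mul => /msuppM_le[a [b [/IHf ea /IHg eb ->]]].
by rewrite /= !degM -ea -eb addnACA.
Qed.

Section Coprod.
Context (V : lmodType rat) (k : (forest * forest)%type -> V).

Lemma linext_coprod1 : linext k (coprod << mone >>) = k (mone, mone).
Proof. by rewrite coprod_one linextU scale1r. Qed.

Lemma linext_coprod_Bplus f : linext k (coprod << ucm (Bplus f) >>) =
  k (ucm (Bplus f), mone) +
    linext (fun p => k (p.1, ucm (Bplus p.2))) (coprod << f >>).
Proof.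
apply: etrans (congr1 (linext k) (coprod_Bplus f)) _.
apply: etrans (linextD _ _ _) _; apply: congr2; first exact: linextU1.
rewrite [LHS]linext_comp; apply: eq_linext => p.
exact: linextU1.
Qed.

Lemma linext_coprod_mul f g : linext k (coprod << mmul f g >>) =
  linext (fun p : (forest * forest)%type =>
    linext (fun q : (forest * forest)%type => k (mmul p.1 q.1, mmul p.2 q.2))
      (coprod << g >>)) (coprod << f >>).
Proof.
apply: etrans (congr1 (linext k) (coprod_mul f g)) _; exact: linext_prod.
Qed.

End Coprod.

Lemma linext_coprod_counitr (V : lmodType rat) (h : forest -> V) f :
  linext (fun p : (forest * forest)%type => if p.2 == mone then h p.1 else 0)
    (coprod << f >>) = h f.
Proof.
have -> : h f = linext h (id_counit (coprod << f >>)).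
  by rewrite coprod_counit linextU1.
rewrite [RHS]linext_comp; apply: eq_linext => p; case: eqP => _.
  exact/esym/linextU1.
exact/esym/linear0.
Qed.

(** The other counit axiom. Under B_+ the term with right factor 1 vanishes, and the remaining ones
    are the case of [f] with [h] composed with B_+. *)
Lemma linext_coprod_counitl (V : lmodType rat) (h : forest -> V) f :
  linext (fun p : (forest * forest)%type => if p.1 == mone then h p.2 else 0)
    (coprod << f >>) = h f.
Proof.
elim/forest_ind: f h => [|f IH|f g IHf IHg] h.
- by rewrite linext_coprod1 eqxx.
- by rewrite linext_coprod_Bplus /= cm1_eq1 add0r (IH (fun f =>
  h (ucm (Bplus f)))).
rewrite linext_coprod_mul -(IHf (fun f => h (mmul f g))).
apply: eq_linext => -[a b] /=; case: (eqVneq a mone) => [->|a1].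
  rewrite -(IHg (fun g => h (mmul b g))); apply: eq_linext => -[c d] /=.
  by rewrite mul1m.
rewrite unlock big1 // => -[c d] _ /=.
by rewrite cmM_eq1 (negPf a1) scaler0.
Qed.

(** * The harmonic product *)

Lemma zprod_cons k s : zprod (k :: s) = z k * zprod s.
Proof. by rewrite /zprod big_cons. Qed.

Lemma zprod0 : zprod [::] = 1.
Proof. by rewrite /zprod big_nil. Qed.

Lemma harm_addl u v w : harm (u + v) w = harm u w + harm v w.
Proof. by have := harmDl 1 u v w; rewrite !scale1r. Qed.

Lemma harm_addr u v w : harm u (v + w) = harm u v + harm u w.
Proof. by have := harmDr 1 u v w; rewrite !scale1r. Qed.

Lemma harm_subr u v w : harm u (v - w) = harm u v - harm u w.
Proof. by rewrite addrC -scaleN1r harmDr scaleN1r addrC. Qed.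

Lemma harmA_rearrange (V : zmodType) (a b c d e1 e2 e3 e f g h i : V) :
  e1 + e2 + e3 = e ->
  a + d + g + e1 + f + (b + e2 + h) + (c + e3 + i) =
  a + b + c + (d + e + f) + (g + h + i).
Proof.
by move=> <-; rewrite [RHS](AC (3*(1*3*1)*3)
  ((1*4*9*5*8)*(2*6*10)*(3*7*11))%AC).
Qed.

Lemma addr_rearrange4 (V : zmodType) (a b c d : V) :
  a + b + c = a - d + (d + b + c).
Proof. by rewrite !addrA addrNK. Qed.

Lemma harmA_zprod s t r : all (leq 1) s -> all (leq 1) t -> all (leq 1) r ->
  harm (harm (zprod s) (zprod t)) (zprod r) =
  harm (zprod s) (harm (zprod t) (zprod r)).
Proof.
elim: s t r => [|k s IHs] t r; first by rewrite zprod0 !harm1l.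
elim: t r => [|l t IHt] r; first by rewrite zprod0 harm1l harm1r.
elim: r => [|m r IHr]; first by rewrite zprod0 !harm1r.
move=> kP lP mP; move: (kP) (lP) (mP) => /= /andP[k1 sP] /andP[l1 tP] /andP[m1
  rP].
(* The seven instances of associativity in which at least one of the three words has lost its first
   letter. *)
move: (IHr kP lP rP) (IHt (m :: r) kP tP mP) (IHs (l :: t) (m :: r) sP lP mP).
move: (IHt r kP tP rP) (IHs t (m :: r) sP tP mP) (IHs (l :: t) r sP lP rP).
move: (IHs t r sP tP rP); rewrite !zprod_cons.
set u := zprod s; set v := zprod t; set w := zprod r => e1 e2 e3 e4 e5 e6 e7.
have kl1 : (1 <= k + l)%N by rewrite addn_gt0 k1.
have lm1 : (1 <= l + m)%N by rewrite addn_gt0 l1.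
rewrite [in LHS]harm_zz // !harm_addl ![in LHS]harm_zz //.
rewrite [in RHS]harm_zz // !harm_addr ![in RHS]harm_zz //.
rewrite e1 e2 e3 e4 e6 e7.
(* On the left the terms starting with z_m alone come out split in three by the expansion of the
   inner product; [e5], expanded and multiplied by z_m, puts them together. *)
move: e5; rewrite [harm (z k * u) (z l * v)]harm_zz // !harm_addl => e5.
move/(congr1 (fun x => z m * x)): e5; rewrite !mulrDr => e5.
rewrite [harm (z l * v) (z m * w)]harm_zz // !harm_addr !mulrDr !addnA.
exact: (harmA_rearrange _ _ _ _ _ _ _ _ e5).
Qed.

Lemma harmA : associative harm.
Proof.
move=> u v w; apply/esym; move: u; apply: HH1_linear_eq =>
  [a u1 u2|a u1 u2|s sP].
- by rewrite !harmDl.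
- by rewrite !harmDl.
move: v; apply: HH1_linear_eq => [a v1 v2|a v1 v2|t tP].
- by rewrite harmDr !harmDl.
- by rewrite harmDl !harmDr.
move: w; apply: HH1_linear_eq => [a w1 w2|a w1 w2|r rP].
- by rewrite !harmDr.
- by rewrite !harmDr.
exact: harmA_zprod.
Qed.

(* The operator N_u: the terms of u * v whose first letter comes
   from u alone. *)
Definition harm_head (u v : HH1) : HH1 :=
  linext (fun m : {fmonom bool} =>
    if zindex m is k :: s then z k * harm (zprod s) v else 0) (val u).

Lemma harm_head_linl a u1 u2 v : harm_head (a *: u1 + u2) v =
  a *: harm_head u1 v + harm_head u2 v.
Proof. by rewrite /harm_head !linearP. Qed.

Lemma harm_head_zprod s v : all (leq 1) s ->
  harm_head (zprod s) v = if s is k :: s' then z k * harm (zprod s') v else 0.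
Proof. by move=> sP; rewrite /harm_head val_zprod linextU scale1r /= zwordK.
  Qed.

Lemma harm_head0 v : harm_head 0 v = 0.
Proof. by rewrite /harm_head linear0. Qed.

Lemma harm_head1 v : harm_head 1 v = 0.
Proof. by rewrite -zprod0 harm_head_zprod. Qed.

Lemma harm_head_addl u1 u2 v : harm_head (u1 + u2) v =
  harm_head u1 v + harm_head u2 v.
Proof. by have := harm_head_linl 1 u1 u2 v; rewrite !scale1r. Qed.

Lemma harm_head_oppl u v : harm_head (- u) v = - harm_head u v.
Proof. by have := harm_head_linl (-1) u 0 v;
  rewrite harm_head0 !addr0 !scaleN1r. Qed.

Lemma harm_head_z k u v : (1 <= k)%N -> harm_head (z k * u) v = z k * harm u v.
Proof.
move=> k1; move: u; apply: HH1_linear_eq => [a u1 u2|a u1 u2|s sP].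
- by rewrite mulrDr HH1_scaleAr harm_head_linl.
- by rewrite harmDl mulrDr HH1_scaleAr.
by rewrite -zprod_cons harm_head_zprod //= k1.
Qed.

Lemma harm_head_linr u a v1 v2 : harm_head u (a *: v1 + v2) =
  a *: harm_head u v1 + harm_head u v2.
Proof.
move: u; apply: HH1_linear_eq => [b u1 u2|b u1 u2|s sP].
- exact: harm_head_linl.
- by rewrite !harm_head_linl !scalerDr !scalerA (mulrC a) addrACA.
rewrite !harm_head_zprod //; case: s sP => [|k s] sP;
  first by rewrite scaler0 addr0.
by rewrite harmDr mulrDr HH1_scaleAr.
Qed.

Lemma harm_head_subr u v1 v2 : harm_head u (v1 - v2) =
  harm_head u v1 - harm_head u v2.
Proof. by rewrite addrC -scaleN1r harm_head_linr scaleN1r addrC. Qed.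

(** Both sides collect the terms of the triple product whose first letter involves no letter of [w].
    If, within the product of [v] and [w], the first letter comes from [v] alone, the term is in the
    second summand, whatever [u] contributes; otherwise the first letter of the term must come from
    [u] alone, which is the first summand. *)
Lemma harm_head_harm u v w :
  harm_head (harm u v) w = harm_head u (harm v w - harm_head v w) +
    harm u (harm_head v w).
Proof.
move: u; apply: HH1_linear_eq => [a u1 u2|a u1 u2|s sP].
- by rewrite harmDl harm_head_linl.
- by rewrite harm_head_linl harmDl scalerDr [RHS]addrACA.
case: s sP => [|k s] /=.
  by rewrite zprod0 harm_head1 !harm1l add0r.
case/andP=> k1 sP; rewrite zprod_cons; set u := zprod s.
move: v; apply: HH1_linear_eq => [a v1 v2|a v1 v2|t tP].
- by rewrite harmDr harm_head_linl.
- rewrite harm_head_linl !harmDl harmDr opprD [X in harm_head _ X]addrACA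
  -scalerBr harm_head_linr.
  by rewrite scalerDr [RHS]addrACA.
case: t tP => [|l t] /=.
  by rewrite zprod0 harm_head1 harm1r harm1l harm0r subr0 addr0.
case/andP=> l1 tP; rewrite zprod_cons; set v := zprod t.
rewrite [in LHS]harm_zz // !harm_head_addl !harm_head_z ?addn_gt0 ?k1 //.
rewrite harm_zz // !harm_subr !mulrBr !harmA.
exact: addr_rearrange4.
Qed.

(** * Homogeneity *)

Lemma homog0 n : homog n 0.
Proof. by move=> m; rewrite msupp0. Qed.

Lemma homogZD n c u v : homog n u -> homog n v -> homog n (c *: u + v).
Proof.
move=> uP vP m /(fsubsetP (msuppD_le (c *: HH1_val u) (HH1_val v))).
rewrite inE => /orP[|/vP //].
by move/(fsubsetP (msuppZ_le _ _)) => /uP.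
Qed.

Lemma homogN n u : homog n u -> homog n (- u).
Proof.
move=> uP; rewrite -scaleN1r -[-1 *: u]addr0.
exact: homogZD uP (@homog0 n).
Qed.

Lemma homogD n u v : homog n u -> homog n v -> homog n (u + v).
Proof. by rewrite -[u in u + v]scale1r; apply: homogZD. Qed.

Lemma homogM m n u v : homog m u -> homog n v -> homog (m + n) (u * v).
Proof.
move=> uP vP k.
case/(@msuppM_le _ _ (HH1_val u) (HH1_val v)) => [a [b [/uP <- /vP <- ->]]].
by rewrite fmM size_cat.
Qed.

Lemma homog_zprod s : all (leq 1) s -> homog (sumn s) (zprod s).
Proof.
move=> sP m; rewrite val_zprod => /(fsubsetP msuppU_le); rewrite inE => /eqP ->.
elim: s sP => //= k s IH /andP[k1 sP].
by rewrite /zword /= size_cat size_rcons size_nseq prednK // IH.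
Qed.

Lemma homog_z k : (1 <= k)%N -> homog k (z k).
Proof.
move=> k1; have := @homog_zprod [:: k]; rewrite /= k1 addn0.
by rewrite zprod_cons zprod0 mulr1; apply.
Qed.

(** The words added all have weight [n], and the remainder stays homogeneous, so that facts about
    homogeneous elements apply to it. *)
Lemma homog_ind n (P : HH1 -> Prop) : P 0 ->
    (forall c s w, all (leq 1) s -> sumn s = n -> homog n w -> P w ->
      P (c *: zprod s + w)) ->
  forall w, homog n w -> P w.
Proof.
move=> P0 PD w wP; suff : homog n w /\ P w by case.
have -> : w = \sum_(m <- msupp (val w)) (val w)@_m *: zprod (zindex m).
  apply: val_inj; rewrite raddf_sum {1}(malg_span (val w)) big_seq [RHS]big_seq.
  apply: eq_bigr => -[m] mw.
  transitivity ((val w)@_(FMonom m) *: val (zprod (zindex m))); last by [].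
  rewrite val_zprod zindexK //.
  by have /allP/(_ _ mw) := valP w.
(* The induction runs over a list, so membership in the support, which gives the weight of each
   word, has to be carried along. *)
have: {subset enum_fset (msupp (val w)) <= msupp (val w)} by [].
move: (enum_fset _) => r; elim: r => [|m r IH] sub.
  by rewrite big_nil; split=> //; apply: homog0.
rewrite big_cons.
have [k ks|hw Pw] := IH; first by apply: sub; rewrite inE ks orbT.
have mw : m \in msupp (val w) by apply: sub; rewrite inE eqxx.
have sm : sumn (zindex m) = n.
  rewrite -(wP m mw) -[m in RHS]fmK -[in RHS](@zindexK m).
    have := zindex_from_pos 0 m; rewrite -/(zindex m).
    elim: (zindex m) => //= k s' IHs /andP[k1 /IHs ->].
    by rewrite /zword /= size_cat size_rcons size_nseq prednK.
  by have /allP/(_ _ mw) := valP w.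
have pm : all (leq 1) (zindex m) := zindex_from_pos 0 m.
split; last exact: PD.
by apply: homogZD => //; rewrite -sm; apply: homog_zprod.
Qed.

Lemma homog_stuffle s t : all (leq 1) s -> all (leq 1) t ->
  homog (sumn s + sumn t) (harm (zprod s) (zprod t)).
Proof.
elim: s t => [|k s IHs] t; first by rewrite zprod0 harm1l => _;
  apply: homog_zprod.
elim: t => [|l t IHt] kP.
  by rewrite zprod0 harm1r addn0 => _; apply: homog_zprod.
move=> lP; case/andP: (kP) => k1 sP; case/andP: (lP) => l1 tP.
have := IHs _ sP lP; have := IHs _ sP tP; have := IHt kP tP.
rewrite !zprod_cons harm_zz //= => h1 h2 h3.
apply: homogD; first apply: homogD.
- by rewrite -addnA; apply: homogM h3; apply: homog_z.
- by rewrite addnCA; apply: homogM h1; apply: homog_z.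
by rewrite addnACA; apply: homogM h2; apply: homog_z; rewrite addn_gt0 k1.
Qed.

Lemma homog_harm m n u v : homog m u -> homog n v -> homog (m + n) (harm u v).
Proof.
move=> uP vP; move: u uP; apply: homog_ind => [|c s u sP sm _ IH].
  by rewrite harm0l; apply: homog0.
rewrite harmDl; apply: homogZD IH.
move: v vP; apply: homog_ind => [|d t v tP tn _ IH].
  by rewrite harm0r; apply: homog0.
by rewrite harmDr; apply: homogZD IH; rewrite -sm -tn; apply: homog_stuffle.
Qed.

(** N_u applied to 1 returns [u] without its constant term, and positive degree rules a constant
    term out. *)
Lemma harm_head_homog n u : (0 < n)%N -> homog n u -> harm_head u 1 = u.
Proof.
move=> n0; move: u; apply: homog_ind => [|c s u sP sn _ IH].
  by rewrite harm_head0.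
have e : harm_head (zprod s) 1 = zprod s.
  rewrite harm_head_zprod //; case: s sn {sP} => [e|k s _];
    last by rewrite harm1r zprod_cons.
  by rewrite -e in n0.
apply: etrans (harm_head_linl _ _ _ _) _.
exact: (congr2 (fun a b : HH1 => c *: a + b) e IH).
Qed.

(* Left multiplication by x, which maps H y, but not H^1, to H^1: the constant
   term is dropped. *)
Definition xshift (u : HH1) : HH1 :=
  linext (fun m : {fmonom bool} =>
    if zindex m is k :: s then zprod (k.+1 :: s) else 0) (val u).

Lemma xshiftDl a u v : xshift (a *: u + v) = a *: xshift u + xshift v.
Proof. by rewrite /xshift !linearP. Qed.

Lemma xshift_zprod s : all (leq 1) s ->
  xshift (zprod s) = if s is k :: s' then zprod (k.+1 :: s') else 0.
Proof. by move=> sP; rewrite /xshift val_zprod linextU scale1r /= zwordK. Qed.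

Lemma xshift0 : xshift 0 = 0.
Proof. by rewrite /xshift linear0. Qed.

Lemma homog_xshift n u : homog n u -> homog n.+1 (xshift u).
Proof.
move: u; apply: homog_ind => [|c s u sP sn _ IH].
  by rewrite xshift0; apply: homog0.
rewrite xshiftDl; apply: homogZD IH; rewrite xshift_zprod //.
case: s sP sn => [_ _|k s /andP[k1 sP] <-]; first exact: homog0.
by apply: homog_zprod.
Qed.

(** * Recursions for N_u and H_u, read in the full algebra *)

Lemma HH1_valM (u v : HH1) : HH1_val (u * v) = HH1_val u * HH1_val v.
Proof. by []. Qed.

Lemma HH1_val_zero : HH1_val 0 = 0. Proof. by []. Qed.

Lemma HH1_val_harm_head_linl a u1 u2 v :
  HH1_val (harm_head (a *: u1 + u2) v) = a *: HH1_val (harm_head u1 v) +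
    HH1_val (harm_head u2 v).
Proof. exact: (congr1 HH1_val (harm_head_linl _ _ _ _)). Qed.

Lemma HH1_val_harm_linl a u1 u2 v :
  HH1_val (harm (a *: u1 + u2) v) = a *: HH1_val (harm u1 v) +
    HH1_val (harm u2 v).
Proof. exact: (congr1 HH1_val (harmDl _ _ _ _)). Qed.

Lemma scale_mulr_rearrange c (x a b : HH) :
  c *: (x * a) + x * b = x * (c *: a + b).
Proof. by rewrite mulrDr malg_scaleAr. Qed.

Lemma scale_mul2_rearrange c (p q a1 a2 b1 b2 d1 d2 : HH) :
  c *: (a1 + (p * b1 + q * d1)) + (a2 + (p * b2 + q * d2)) =
  (c *: a1 + a2) + (p * (c *: b1 + b2) + q * (c *: d1 + d2)).
Proof.
rewrite -2!scale_mulr_rearrange 2!scalerDr [LHS]addrACA; congr (_ + _).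
exact: addrACA.
Qed.

Lemma exp_pred_rearrange (R : pzRingType) (a b : R) k l : (1 <= k)%N ->
  a ^+ (k + l).-1 * b = a ^+ l * (a ^+ k.-1 * b).
Proof. by move=> k1; rewrite mulrA -exprD -!subn1 addnC addnBA. Qed.

Lemma HH1_valD3 (u v w : HH1) : HH1_val (u + v + w) =
  HH1_val u + (HH1_val v + HH1_val w).
Proof. exact: (congr1 HH1_val (esym (addrA u v w))). Qed.

Lemma HH1_val_zDM l k w : (1 <= k)%N ->
  HH1_val (z (k + l) * w) = X ^+ l * HH1_val (z k * w).
Proof.
move=> k1; have e : HH1_val (z (k + l)) = X ^+ l * HH1_val (z k).
  exact: exp_pred_rearrange.
apply: etrans (HH1_valM _ _) _; apply: etrans (congr1 (fun t =>
  t * HH1_val w) e) _.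
exact: (esym (mulrA _ _ _)).
Qed.

(** The shift only raises the index of the first letter of [u], and N_u leaves that letter in
    front. *)
Lemma harm_head_xshift u v : HH1_val (harm_head (xshift u) v) =
  X * HH1_val (harm_head u v).
Proof.
move: u; apply: HH1_ind => [|c s u sP IH].
  by rewrite xshift0 harm_head0 HH1_val_zero mulr0.
have e : HH1_val (harm_head (xshift (zprod s)) v) =
  X * HH1_val (harm_head (zprod s) v).
  case: s sP => [sP|k s ksP].
    have e1 : harm_head (xshift (zprod [::])) v = 0.
      by rewrite xshift_zprod // harm_head0.
    rewrite zprod0 harm_head1 HH1_val_zero mulr0; apply: etrans HH1_val_zero.
    by rewrite -zprod0; apply: (congr1 HH1_val e1).
  have e1 : harm_head (xshift (zprod (k :: s))) v = z k.+1 * harm (zprod s) v.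
    by rewrite xshift_zprod //; apply: harm_head_zprod; case/andP: ksP.
  apply: etrans (congr1 HH1_val e1) _.
  apply: etrans _ (congr1 (fun w => X * HH1_val w) (esym
    (harm_head_zprod v ksP))).
  have ek : z k.+1 = z (k + 1) by rewrite addn1.
  apply: etrans (congr1 (fun t => HH1_val (t * _)) ek) _.
  by apply: (@HH1_val_zDM 1 k); case/andP: ksP.
apply: etrans (congr1 (fun w => HH1_val (harm_head w v)) (xshiftDl _ _ _)) _.
apply: etrans (HH1_val_harm_head_linl _ _ _ _) _.
apply: etrans (congr2 (fun a b : HH => c *: a + b) e IH) _.
apply: etrans (scale_mulr_rearrange _ _ _ _) _.
exact: (congr1 (fun w => X * w) (esym (HH1_val_harm_head_linl _ _ _ _))).
Qed.

(* The last term collects the contractions, since z_(k + l) = x^l z_k. *)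
Lemma harm_zr u l v : (1 <= l)%N -> HH1_val (harm u (z l * v)) =
  HH1_val (harm_head u (z l * v)) + (HH1_val (z l) * HH1_val (harm u v) +
    X ^+ l * HH1_val (harm_head u v)).
Proof.
move=> l1; move: u; apply: HH1_ind => [|c s u sP IH].
  by rewrite !harm0l !harm_head0 HH1_val_zero !mulr0 !addr0.
have e : HH1_val (harm (zprod s) (z l * v)) =
  HH1_val (harm_head (zprod s) (z l * v)) +
    (HH1_val (z l) * HH1_val (harm (zprod s) v) +
      X ^+ l * HH1_val (harm_head (zprod s) v)).
  case: s sP => [_|k s ksP].
    by rewrite zprod0 !harm1l !harm_head1 HH1_val_zero mulr0 add0r addr0.
  have /andP[k1 sP] := ksP.
  apply: etrans (congr1 (fun t => HH1_val (harm t (z l * v)))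
    (zprod_cons k s)) _.
  apply: etrans (congr1 HH1_val (harm_zz _ _ k1 l1)) _.
  apply: etrans (HH1_valD3 _ _ _) _.
  apply: esym.
  apply: etrans (congr2 (fun a b : HH => a + b)
    (congr1 HH1_val (harm_head_zprod _ ksP))
    (congr2 (fun a b : HH => a + b)
      (etrans (congr1 (fun t => HH1_val (z l) * HH1_val (harm t v))
        (zprod_cons k s))
        (esym (HH1_valM _ _)))
      (etrans (congr1 (fun t => X ^+ l * HH1_val t) (harm_head_zprod _ ksP))
        (esym (HH1_val_zDM _ _ k1))))) _.
  reflexivity.
apply: etrans (HH1_val_harm_linl _ _ _ _) _.
apply: etrans (congr2 (fun a b : HH => c *: a + b) e IH) _.
apply: etrans (scale_mul2_rearrange _ _ _ _ _ _ _ _ _) _.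
apply: esym.
apply: etrans (congr2 (fun a b : HH => a + b)
  (HH1_val_harm_head_linl _ _ _ _)
  (congr2 (fun a b : HH => HH1_val (z l) * a + X ^+ l * b)
     (HH1_val_harm_linl _ _ _ _) (HH1_val_harm_head_linl _ _ _ _))) _.
reflexivity.
Qed.

Lemma HH1_valB (u v : HH1) : HH1_val (u - v) = HH1_val u - HH1_val v.
Proof. by []. Qed.

Lemma harm_oppl u v : harm (- u) v = - harm u v.
Proof. by have := harmDl (-1) u 0 v; rewrite harm0l !addr0 !scaleN1r. Qed.

Lemma harm_headr0 u : harm_head u 0 = 0.
Proof. by have := harm_head_subr u 0 0; rewrite !subrr. Qed.

(** With [a] = x^(l-1), [h] = H_u w and [n] = N_u w, this brings the rule for f' at z_l w to the
    shape of [harm_zr]. *)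
Lemma bridge_rearrange (R : pzRingType) (a x y h n : R) :
  a * (y * (h - n) - (x + y) * (- n)) = a * y * h + a * x * n.
Proof.
have -> : y * (h - n) - (x + y) * (- n) = y * h + x * n.
  by rewrite mulrN opprK mulrDl addrCA mulrBr subrK addrC.
by rewrite mulrDr !mulrA.
Qed.

Lemma lin_sub_rearrange (V : lmodType rat) c (a b a' b' : V) :
  c *: (a - b) + (a' - b') = c *: a + a' - (c *: b + b').
Proof. by rewrite scalerBr opprD addrACA. Qed.

(** * Conjugation of the rooted forest maps *)

Definition psi : HH -> HH := phi \o tau.
Definition psi_inv : HH -> HH := tau \o phi.

HB.instance Definition _ := GRing.Linear.on psi.
HB.instance Definition _ := GRing.Linear.on psi_inv.

Lemma psi_invK : cancel psi_inv psi.
Proof. by move=> w; rewrite /psi /psi_inv /= tauK phiK. Qed.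

Lemma psiK : cancel psi psi_inv.
Proof. by move=> w; rewrite /psi /psi_inv /= phiK tauK. Qed.

Lemma psiM v w : psi (v * w) = psi w * psi v.
Proof. by rewrite /psi /= tauM phiM. Qed.

Lemma psi_invM v w : psi_inv (v * w) = psi_inv w * psi_inv v.
Proof. by rewrite /psi_inv /= phiM tauM. Qed.

Lemma psiD : {morph psi : v w / v + w}. Proof. exact: linearD. Qed.
Lemma psiN : {morph psi : v / - v}. Proof. exact: linearN. Qed.
Lemma psi_invD : {morph psi_inv : v w / v + w}. Proof. exact: linearD. Qed.
Lemma psi_invN : {morph psi_inv : v / - v}. Proof. exact: linearN. Qed.

Lemma psi_invX : psi_inv X = Z.
Proof. by rewrite /psi_inv /= phi_word big_seq1 /= tauD !tau_word addrC. Qed.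

Lemma psi_invY : psi_inv Y = - X.
Proof. by rewrite /psi_inv /= phi_word big_seq1 /= linearN /= tau_word. Qed.

Lemma psi_invZ : psi_inv Z = Y.
Proof. by rewrite psi_invD psi_invX psi_invY addrC addrA addNr add0r. Qed.

Lemma psi_inv1 : psi_inv 1 = 1.
Proof. by rewrite /psi_inv /= phi1 -word0; apply: tau_word. Qed.

Lemma psiX : psi X = - Y.
Proof. by rewrite -[RHS]psi_invK psi_invN psi_invY opprK. Qed.

Lemma psiZ : psi Z = X.
Proof. by rewrite -psi_invX psi_invK. Qed.

Lemma psiY : psi Y = Z.
Proof. by rewrite -{1}psi_invZ psi_invK. Qed.

Lemma psi_inv_mulZ v : psi_inv (Z * v) = psi_inv v * Y.
Proof. by rewrite psi_invM psi_invZ. Qed.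

Lemma mulD_rearrange (R : pzRingType) (a b c d : R) :
  a * c + (b * c - (a + b) * d) = (a + b) * (c - d).
Proof. by rewrite addrA -mulrDl mulrBr. Qed.

(** Left multiplication by z becomes right multiplication by y under psi^-1, hence is injective.
    Identities for A_f are proved below after multiplication by z, since f' determines z A_f. *)
Lemma mulZI v w : Z * v = Z * w -> v = w.
Proof.
move/(congr1 psi_inv) => e; apply: (can_inj psi_invK).
have {}e : psi_inv v * Y = psi_inv w * Y.
  exact: etrans (esym (psi_inv_mulZ v)) (etrans e (psi_inv_mulZ w)).
exact: etrans (esym (Ry_invK _)) (etrans (congr1 Ry_inv e) (Ry_invK _)).
Qed.

Lemma HH_word_ind (P : HH -> Prop) : P 0 ->
    (forall c v w, P v -> P w -> P (c *: v + w)) -> P 1 ->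
    (forall w, P w -> P (X * w)) -> (forall w, P w -> P (Y * w)) ->
  forall w, P w.
Proof.
move=> P0 PD P1 PX PY; apply: HH_ind => // c s w Pw; apply: PD => //.
elim: s => [|u s IH]; first by rewrite word0.
by rewrite -cat1s -wordM; case: u; [apply: PY|apply: PX].
Qed.

Lemma linext_0 (K : choiceType) (V : lmodType rat) (g : {malg rat[K]}) :
  linext (fun _ => 0 : V) g = 0.
Proof. by rewrite unlock big1 // => k _; rewrite scaler0. Qed.

Lemma linextN (K : choiceType) (V : lmodType rat) (h : K -> V)
    (g : {malg rat[K]}) : linext (fun k => - h k) g = - linext h g.
Proof. by rewrite unlock -sumrN; apply: eq_bigr => k _; rewrite scalerN. Qed.

Lemma psi_linext (K : choiceType) (h : K -> HH) g :
  psi (linext h g) = linext (fun k => psi (h k)) g.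
Proof. exact: linext_comp. Qed.

Lemma linext_mulB (K : choiceType) (a b : HH) (h1 h2 : K -> HH) g :
  a * linext h1 g - b * linext h2 g = linext (fun k => a * h1 k - b * h2 k) g.
Proof.
rewrite unlock !mulr_sumr -sumrB; apply: eq_bigr => k _.
by rewrite -!malg_scaleAr scalerBr.
Qed.

Lemma linext_exchange (K L : choiceType) (V : lmodType rat) (h : K -> L -> V)
    g1 g2 :
  linext (fun l => linext (fun k => h k l) g1) g2 =
  linext (fun k => linext (fun l => h k l) g2) g1.
Proof.
rewrite unlock; under eq_bigr do rewrite scaler_sumr.
rewrite exchange_big; apply: eq_bigr => k _; rewrite scaler_sumr.
by apply: eq_bigr => l _; rewrite !scalerA mulrC.
Qed.

Lemma mulrD_rearrange (R : pzRingType) (a b u v w : R) :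
  b * u - (b * u - a * v - a * w) = a * (v + w).
Proof. by rewrite mulrDr -addrA -opprD subKr. Qed.

Lemma mulrB_rearrange (R : pzRingType) (a b c d e : R) :
  (a * c - b * d) * e = a * (c * e) - b * (d * e).
Proof. by rewrite mulrBl !mulrA. Qed.

Lemma bplus_rearrange (R : pzRingType) (x y h n : R) :
  (x + (x + y)) * (- n) - y * (h - n) = - (x * n + x * n + y * h).
Proof.
rewrite mulrBr opprB mulrN !mulrDl !opprD -!addrA; congr (_ + (_ + _)).
by rewrite addKr.
Qed.

Section ForestMaps.
Context (Phi : forest -> {linear HH -> HH}) (PhiP : is_forest_maps Phi).

Lemma forest_mapD f : {morph Phi f : v w / v + w}. Proof. exact: linearD. Qed.
Lemma forest_mapN f : {morph Phi f : v / - v}. Proof. exact: linearN. Qed.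
Lemma Ry_inv0 : Ry_inv 0 = 0. Proof. exact: linear0. Qed.
Lemma Ry_invD : {morph Ry_inv : v w / v + w}. Proof. exact: linearD. Qed.

(** The values of the one-vertex tree at x and y are opposite, and the rules for B_+ and for
    products apply one linear operator to both letters. *)
Lemma forest_map_Z f : f != mone -> Phi f Z = 0.
Proof.
elim/forest_ind: f => [|f IH _|f g IHf IHg fg1]; first by rewrite eqxx.
  have [->|f1] := eqVneq f mone.
    by rewrite forest_mapD (forest_map_bullet_x PhiP)
      (forest_map_bullet_y PhiP) addrN.
  rewrite forest_mapD 2?(forest_map_Bplus PhiP) // -2!mulrDl -Ry_invD
    -forest_mapD.
  by rewrite IH // linear0 !mul0r.
have [f1|f1] := eqVneq f mone.
  by rewrite f1 mul1m in fg1 *; apply: IHg.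
have [g1|g1] := eqVneq g mone.
  by rewrite g1 mulm1 in fg1 *; apply: IHf.
by rewrite forest_mapD 2?(forest_map_mul PhiP) // -2!forest_mapD IHg // linear0.
Qed.

(** As nonempty forests kill z, only the terms of the coproduct with right factor 1 survive. *)
Lemma forest_map_mulZ f w : Phi f (w * Z) = Phi f w * Z.
Proof.
rewrite -(linext_coprod_counitr (fun g => Phi g w * Z)).
apply: etrans (congr1 (Phi f) (mulrDr w X Y)) _.
apply: etrans (forest_mapD _ _ _) _.
apply: etrans (congr2 +%R (forest_map_coprod PhiP f w false)
  (forest_map_coprod PhiP f w true)) _.
have := linextP (fun p : (forest * forest)%type => Phi p.1 w * Phi p.2 X)
  (fun p => Phi p.1 w * Phi p.2 Y) 1 (coprod << f >>).
rewrite scale1r => <-; apply: eq_linext => p;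
  rewrite scale1r -mulrDr -forest_mapD.
have [->|p1] := eqVneq p.2 mone; first by rewrite (forest_map1 PhiP).
by rewrite forest_map_Z // mulr0.
Qed.

(** Computing f(y) as f(1 y), by induction on the degree only the two extreme terms of the coproduct
    survive: f(y) = f(y) + f(1) y. *)
Lemma forest_map_of1 f : f != mone -> Phi f 1 = 0.
Proof.
have [n] := ubnP (deg f); elim: n f => // n IH f; rewrite ltnS => fn f1.
have := forest_map_coprod PhiP f 1 true; rewrite mul1r /coact.
rewrite (@eq_linext_in _ _ _ (fun p : (forest * forest)%type =>
  1 *: (if p.1 == mone then Phi p.2 Y else 0)
    + (if p.2 == mone then Phi p.1 1 * Y else 0))); last first.
  move=> [a b] /coprod_deg /= e; rewrite scale1r.
  have [ea|a1] := eqVneq a mone; have [eb|b1] := eqVneq b mone.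
  - by case/eqP: f1; apply/eqP; rewrite -deg_eq0 -e ea eb deg1.
  - by rewrite ea (forest_map1 PhiP) mul1r addr0.
  - by rewrite eb (forest_map1 PhiP) add0r.
  rewrite IH ?mul0r ?addr0 //; apply: leq_trans fn;
    rewrite -e -[X in (X < _)%N]addn0.
  by rewrite ltn_add2l lt0n deg_eq0.
rewrite linextP scale1r (linext_coprod_counitl (fun g => Phi g Y)).
rewrite (linext_coprod_counitr (fun g => Phi g 1 * Y)) -[LHS]addr0.
by move/addrI/(congr1 Ry_inv); rewrite linear0 Ry_invK.
Qed.

(* The maps f' = psi f psi^-1 and, next, A_f. *)
Definition conj_map f v := psi (Phi f (psi_inv v)).
Definition conj_phiRx f v := psi (phi_Rx (Phi f) (psi_inv v)).

Lemma conj_map_is_linear f : linear (conj_map f).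
Proof. by move=> a v w; rewrite /conj_map !linearP. Qed.

HB.instance Definition _ f := GRing.isLinear.Build rat HH HH *:%R (conj_map f)
  (conj_map_is_linear f).

Lemma conj_mapD f : {morph conj_map f : v w / v + w}.
Proof. exact: linearD. Qed.

Lemma conj_map1 v : conj_map mone v = v.
Proof. by rewrite /conj_map (forest_map1 PhiP) psi_invK. Qed.

Lemma conj_map_of1 f : f != mone -> conj_map f 1 = 0.
Proof. by move=> f1; rewrite /conj_map psi_inv1 forest_map_of1 // linear0. Qed.

Lemma conj_map_X f v : conj_map f (X * v) = X * conj_map f v.
Proof.
by rewrite /conj_map psi_invM psi_invX forest_map_mulZ psiM psiZ.
Qed.

(** This is the image under psi of the equation defining [phi_Rx]: psi reverses products and sends y
    to z and x to -y. *)
Lemma Z_conj_phiRx f v : Z * conj_phiRx f v =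
  Y * conj_map f v - conj_map f (Y * v).
Proof.
rewrite /conj_phiRx /conj_map -{1}psiY -psiM (phi_RxP _ _ PhiP) psiD psiN psiM
  psiX.
by rewrite psi_invM psi_invY mulrN mulNr forest_mapN psiN 2!opprK addrC.
Qed.

Lemma conj_map_Y f v : conj_map f (Y * v) =
  Y * conj_map f v - Z * conj_phiRx f v.
Proof. by rewrite Z_conj_phiRx opprB addrC subrK. Qed.

Lemma conj_phiRx_mone v : conj_phiRx mone v = 0.
Proof. by apply: mulZI; rewrite Z_conj_phiRx 2!conj_map1 subrr mulr0. Qed.

Lemma conj_map_Z f v : conj_map f (Z * v) = Z * (conj_map f v - conj_phiRx f v).
Proof.
apply: etrans (congr1 (conj_map f) (mulrDl X Y v)) _.
apply: etrans (conj_mapD _ _ _) _.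
apply: etrans (congr2 +%R (conj_map_X f v) (conj_map_Y f v)) _.
exact: mulD_rearrange.
Qed.

(** Since chi_x v = psi^-1 (z v) and chi_x^-1 = psi R_y^-1, the left side is f'(z v) with its
    leading z removed. *)
Lemma chi_inv_forest_map f v :
  chi_inv (Phi f (chi v)) = conj_map f v - conj_phiRx f v.
Proof.
have -> : chi v = psi_inv (Z * v).
  by rewrite psi_inv_mulZ /chi tauM tau_word.
have -> : chi_inv (Phi f (psi_inv (Z * v))) =
    psi (Ry_inv (Phi f (psi_inv (Z * v)))) by [].
apply: mulZI; rewrite -{1}psiY -psiM HHy_Ry_inv; last first.
  apply: (forest_map_HHy _ PhiP); rewrite psi_inv_mulZ.
  by apply/HHyP; exists (psi_inv v).
exact: conj_map_Z.
Qed.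

(** * The map phi_f R_x and the coproduct *)

Lemma phi_Rx_mone w : phi_Rx (Phi mone) w = 0.
Proof. by rewrite /phi_Rx !(forest_map1 PhiP) subrr Ry_inv0. Qed.

Lemma phi_Rx_of1 f : f != mone -> phi_Rx (Phi f) 1 = Ry_inv (Phi f X).
Proof.
by move=> f1; rewrite /phi_Rx (forest_map_of1 f1) mul0r subr0 mul1r.
Qed.

(** In f(w x) the terms with right factor 1 add up to the subtracted f(w) x; in each other term b(x)
    ends with y. *)
Lemma phi_Rx_coprod f w : phi_Rx (Phi f) w =
  linext (fun p : (forest * forest)%type =>
    Phi p.1 w * phi_Rx (Phi p.2) 1) (coprod << f >>).
Proof.
rewrite {1}/phi_Rx (forest_map_coprod PhiP) /coact.
rewrite -(linext_coprod_counitr (fun g => Phi g w * X)) addrC -scaleN1r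
  -linextP.
rewrite linext_comp; apply: eq_linext => p.
have [->|p1] := eqVneq p.2 mone.
  rewrite phi_Rx_mone (forest_map1 PhiP) scaleN1r addNr mulr0.
  exact: Ry_inv0.
rewrite (phi_Rx_of1 p1) scaler0 add0r.
case/HHyP: (forest_map_letter PhiP false p1) => v e2; rewrite e2 mulrA.
apply: etrans (Ry_invK _) _; congr (_ * _); exact: esym (Ry_invK _).
Qed.

(** The coproduct of B_+(f) contributes terms with right factor B_+(b). Those with b = 1 give f(w)
    x, because the one-vertex tree sends x to xy; the others give the factor y + z. *)
Lemma phi_Rx_Bplus f w : phi_Rx (Phi (ucm (Bplus f))) w =
  Phi f w * X + phi_Rx (Phi f) w * (Y + Z).
Proof.
apply: etrans (phi_Rx_coprod _ _) _; rewrite linext_coprod_Bplus.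
apply: etrans (congr2 +%R (etrans (congr1 (GRing.mul _) (phi_Rx_mone 1))
  (mulr0 _)) (erefl _)) _; rewrite add0r.
rewrite phi_Rx_coprod linext_mulr.
rewrite -(linext_coprod_counitr (fun g => Phi g w * X)).
rewrite -[U in _ = U + _]scale1r -linextP; apply: eq_linext => p /=.
rewrite scale1r -mulrA phi_Rx_of1 ?cm1_eq1 //.
have [->|p1] := eqVneq p.2 mone.
  by rewrite phi_Rx_mone (forest_map_bullet_x PhiP) Ry_invK mul0r mulr0 addr0.
rewrite add0r (phi_Rx_of1 p1) (forest_map_Bplus PhiP _ p1).
by congr GRing.mul; apply: Ry_invK.
Qed.

Lemma conj_phiRx_Bplus f v :
  conj_phiRx (ucm (Bplus f)) v = (X + Z) * conj_phiRx f v - Y * conj_map f v.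
Proof.
apply: etrans (congr1 psi (phi_Rx_Bplus _ _)) _; rewrite psiD addrC.
apply: etrans (congr2 +%R (psiM _ _) (psiM _ _)) _.
by rewrite psiX mulNr psiD psiZ psiY [Z + X]addrC.
Qed.

(** * The Leibniz rule and multiplicativity of f' *)

Lemma conj_mapZD f c v w : conj_map f (c *: v + w) =
  c *: conj_map f v + conj_map f w.
Proof. exact: conj_map_is_linear. Qed.

Lemma conj_mapB f v w : conj_map f (v - w) = conj_map f v - conj_map f w.
Proof. exact: linearB. Qed.

Lemma conj_map0 f : conj_map f 0 = 0.
Proof. exact: linear0. Qed.

(** The two tensor factors are exchanged because psi reverses products. *)
Definition fcoact f v w : HH :=
  linext (fun p : (forest * forest)%type => conj_map p.2 v * conj_map p.1 w)
    (coprod << f >>).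

(** The axiom of forest maps gives this when [v] is a single letter, up to linearity. The general
    rule reflects coassociativity of the coproduct; here it is proved by induction on forests. *)
Definition conj_map_leibniz f := forall v w, conj_map f (v * w) = fcoact f v w.

Lemma fcoact0l f w : fcoact f 0 w = 0.
Proof.
apply: etrans (linext_0 HH (coprod << f >>)); apply: eq_linext => p.
by rewrite conj_map0 mul0r.
Qed.

Lemma fcoactDl f c v1 v2 w :
  fcoact f (c *: v1 + v2) w = c *: fcoact f v1 w + fcoact f v2 w.
Proof.
apply: etrans _ (linextP _ _ _ _); apply: eq_linext => p.
by rewrite conj_mapZD mulrDl scalerAl.
Qed.

Lemma fcoact_X f v w : fcoact f (X * v) w = X * fcoact f v w.
Proof.
rewrite linext_mull; apply: eq_linext => p.
by rewrite conj_map_X mulrA.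
Qed.

Lemma fcoact_of1 f w : fcoact f 1 w = conj_map f w.
Proof.
rewrite -(linext_coprod_counitr (fun g => conj_map g w)); apply: eq_linext => p.
have [->|p1] := eqVneq p.2 mone; first by rewrite conj_map1 mul1r.
by rewrite (conj_map_of1 p1) mul0r.
Qed.

Lemma fcoact_letterY f w : conj_map f (Y * w) = fcoact f Y w.
Proof.
apply: etrans (congr1 (fun v => psi (Phi f v)) (psi_invM _ _)) _.
rewrite psi_invY mulrN forest_mapN psiN (forest_map_coprod PhiP) /coact.
rewrite psi_linext -linextN; apply: eq_linext => p.
rewrite psiM -mulNr -psiN -forest_mapN -psi_invY.
by [].
Qed.

Lemma fcoact_Y f v w :
  fcoact f (Y * v) w = Y * fcoact f v w -
    Z * linext (fun p : (forest * forest)%type =>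
      conj_phiRx p.2 v * conj_map p.1 w) (coprod << f >>).
Proof.
apply: esym; apply: etrans (linext_mulB _ _ _ _ _) _; apply: eq_linext => p.
apply: etrans _ (congr1 (fun a => a * _) (esym (conj_map_Y _ _))).
exact/esym/mulrB_rearrange.
Qed.

(** Apply the Leibniz rule to f' at y v w, with y v as the first factor, and cancel z. *)
Lemma conj_phiRx_leibniz f v w : conj_map_leibniz f ->
  conj_phiRx f (v * w) = linext (fun p : (forest * forest)%type =>
    conj_phiRx p.2 v * conj_map p.1 w) (coprod << f >>).
Proof.
move=> fP; apply: mulZI; apply: etrans (Z_conj_phiRx _ _) _.
have e : conj_map f (Y * (v * w)) = _ :=
  etrans (congr1 (conj_map f) (mulrA _ _ _)) (etrans (fP _ _) (fcoact_Y f v w)).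
by apply: etrans (congr2 (fun a b => Y * a - b) (fP v w) e) _; apply: subKr.
Qed.

Lemma conj_map_leibniz_mone : conj_map_leibniz mone.
Proof.
by move=> v w; rewrite /fcoact linext_coprod1 !conj_map1.
Qed.

(** Induction on [v]: a letter x passes through, and a letter y leaves the product rule for A_(B+
    f), which the recursion for A_(B+ f) reduces to the rules for A_f and f'. *)
Lemma conj_map_leibniz_Bplus f : conj_map_leibniz f ->
  conj_map_leibniz (ucm (Bplus f)).
Proof.
move=> fP; apply: HH_word_ind => [|c v1 v2 IH1 IH2||v IH|v IH] w.
- by rewrite mul0r conj_map0 fcoact0l.
- have -> : (c *: v1 + v2) * w = c *: (v1 * w) + v2 * w.
    by rewrite mulrDl scalerAl.
  apply: etrans (conj_mapZD _ _ _ _) _.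
  apply: etrans (congr2 (fun a b => c *: a + b) (IH1 w) (IH2 w)) _.
  exact/esym/fcoactDl.
- by rewrite mul1r fcoact_of1.
- by rewrite -mulrA conj_map_X IH fcoact_X.
rewrite -mulrA conj_map_Y IH fcoact_Y; congr (_ - _ * _).
apply: etrans (conj_phiRx_Bplus _ _) _.
apply: etrans (congr2 (fun a b => (X + Z) * a - Y * b)
  (conj_phiRx_leibniz v w fP) (fP v w)) _.
apply: esym; apply: etrans (linext_coprod_Bplus _ _) _.
apply: etrans (congr2 +%R (etrans (congr1 (fun a => a * _)
  (conj_phiRx_mone v)) (mul0r _)) (erefl _)) _.
apply: etrans (add0r _) _; apply: esym.
apply: etrans (linext_mulB _ _ _ _ _) _; apply: eq_linext => p.
apply: etrans _ (congr1 (fun a => a * _) (esym (conj_phiRx_Bplus _ _))).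
exact/esym/mulrB_rearrange.
Qed.

(** Multiplicativity is asked only at the given [v] and [w] and in degree at most that of [g], so
    that the lemma can serve inside the induction proving multiplicativity. *)
Lemma fcoact_mul g h v w : conj_map_leibniz g ->
    (forall b d, (deg b <= deg g)%N -> conj_map (mmul b d) v =
      conj_map b (conj_map d v)) ->
    (forall a c, (deg a <= deg g)%N -> conj_map (mmul a c) w =
      conj_map a (conj_map c w)) ->
  fcoact (mmul g h) v w = conj_map g (fcoact h v w).
Proof.
move=> gP vP wP; apply: etrans (linext_coprod_mul _ _ _) _.
apply: esym; apply: etrans (linext_comp (conj_map g) _ _) _.
apply: etrans (eq_linext (fun q => gP (conj_map q.2 v) (conj_map q.1 w)) _) _.
apply: etrans (linext_exchange _ _ _) _.
apply: eq_linext_in => p /coprod_deg e; apply: eq_linext => q.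
apply: congr2; apply: esym; [apply: vP|apply: wP].
  by rewrite -e leq_addl.
by rewrite -e leq_addr.
Qed.

Lemma conj_map_mul_letterY g h : conj_map (mmul g h) Y =
  conj_map g (conj_map h Y).
Proof.
have [->|g1] := eqVneq g mone; first by rewrite mul1m conj_map1.
have [->|h1] := eqVneq h mone; first by rewrite mulm1 conj_map1.
rewrite /conj_map psi_invY psiK !forest_mapN; congr psi; congr (- _).
exact: forest_map_mul.
Qed.

(* The Leibniz rule is only available up to the degree of g at this point: it is
   proved for all forests by an induction on the degree that uses this lemma. *)
Lemma conj_map_mul_leibniz g h w :
    (forall g', (deg g' <= deg g)%N -> conj_map_leibniz g') ->
  conj_map (mmul g h) w = conj_map g (conj_map h w).
Proof.
move: w g h; apply: HH_word_ind => [g h _|c v w IHv IHw g h gP|g h gP|w IH g h gP|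
  w IH g h gP].
- by rewrite !conj_map0.
- by rewrite 3!conj_mapZD IHv // IHw.
- have [->|g1] := eqVneq g mone; first by rewrite mul1m conj_map1.
  rewrite conj_map_of1 ?cmM_eq1 ?(negPf g1) //.
  have [->|h1] := eqVneq h mone; first by rewrite conj_map1 conj_map_of1.
  by rewrite (conj_map_of1 h1) conj_map0.
- by rewrite 3!conj_map_X IH.
(* With y split off, multiplicativity on the first factor is the axiom on letters, and on the second
   it is the induction hypothesis. *)
rewrite 2!fcoact_letterY; apply: fcoact_mul => [|b d _|a c ag]; first exact: gP.
  exact: conj_map_mul_letterY.
by apply: IH => g' g'a; apply: gP; apply: leq_trans ag.
Qed.

Lemma conj_map_coprod f : conj_map_leibniz f.
Proof.
have [n] := ubnP (deg f); elim: n f => // n IH f; rewrite ltnS.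
case: (forestP f) => [->|[g ->]|[g [h [g1 h1 ->]]]].
  by move=> _; apply: conj_map_leibniz_mone.
  by rewrite deg_Bplus => /IH; apply: conj_map_leibniz_Bplus.
rewrite degM => ghn.
(* As [h] is nonempty, even forests of the same degree as [g] fall under the induction
   hypothesis. *)
have gP g' : (deg g' <= deg g)%N -> conj_map_leibniz g'.
  move=> g'g; apply: IH; apply: leq_ltn_trans g'g (leq_trans _ ghn).
  by rewrite -[X in (X < _)%N]addn0 ltn_add2l lt0n deg_eq0.
have hP : conj_map_leibniz h.
  by apply: IH; apply: leq_trans ghn;
    rewrite -[X in (X < _)%N]add0n ltn_add2r lt0n deg_eq0.
move=> v w; rewrite conj_map_mul_leibniz // hP; apply: esym.
have gP' g' : (deg g' <= deg g)%N -> forall k, (deg k <= deg g')%N ->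
  conj_map_leibniz k.
  by move=> g'g k kg'; apply: gP; apply: leq_trans g'g.
apply: fcoact_mul => [|b d bg|a c ag]; first exact: gP.
  exact/conj_map_mul_leibniz/gP'.
exact/conj_map_mul_leibniz/gP'.
Qed.

Lemma conj_map_mul g h w : conj_map (mmul g h) w = conj_map g (conj_map h w).
Proof. by apply: conj_map_mul_leibniz => f _; apply: conj_map_coprod. Qed.

(** Comes from pushing y, then z, through g' after h' and cancelling z. *)
Lemma conj_phiRx_mul g h w :
  conj_phiRx (mmul g h) w = conj_phiRx g (conj_map h w) +
    (conj_map g (conj_phiRx h w) - conj_phiRx g (conj_phiRx h w)).
Proof.
apply: mulZI; apply: etrans (Z_conj_phiRx _ _) _.
have e : conj_map (mmul g h) (Y * w) = Y * conj_map g (conj_map h w) -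
    Z * conj_phiRx g (conj_map h w) -
    Z * (conj_map g (conj_phiRx h w) - conj_phiRx g (conj_phiRx h w)).
  apply: etrans (conj_map_mul g h (Y * w)) _.
  apply: etrans (congr1 (conj_map g) (conj_map_Y _ _)) _.
  apply: etrans (conj_mapB _ _ _) _.
  exact: (congr2 (fun a b : HH => a - b) (conj_map_Y _ _) (conj_map_Z _ _)).
apply: etrans (congr2 (fun a b => Y * a - b) (conj_map_mul g h w) e) _.
exact: mulrD_rearrange.
Qed.

(** * The conjugated maps as harmonic products *)

Lemma conj_map_Xn f n v : conj_map f (X ^+ n * v) = X ^+ n * conj_map f v.
Proof.
elim: n => [|n IH]; first by rewrite !mul1r.
apply: etrans (congr1 (fun w => conj_map f (w * v)) (exprS _ _)) _.
apply: etrans (congr1 (conj_map f) (esym (mulrA _ _ _))) _.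
apply: etrans (conj_map_X _ _) _.
apply: etrans (congr1 (fun w : HH => X * w) IH) _.
apply: etrans (mulrA _ _ _) _.
exact: (congr1 (fun w : HH => w * conj_map f v) (esym (exprS _ _))).
Qed.

(** Both sides vanish at 1, which is where N_u 1 = [u] enters, and obey the same recursion at z_l
    w. *)
Lemma conj_map_HH1 f u v : f != mone -> harm_head u 1 = u ->
    (forall v, conj_phiRx f (HH1_val v) = - HH1_val (harm_head u v)) ->
  conj_map f (HH1_val v) = HH1_val (harm u v) - HH1_val (harm_head u v).
Proof.
move=> f1 u1 A; move: v; apply: HH1_ind => [|c s v sP IH].
  by rewrite harm0r harm_headr0 HH1_val_zero conj_map0 subrr.
have e : conj_map f (HH1_val (zprod s)) =
    HH1_val (harm u (zprod s)) - HH1_val (harm_head u (zprod s)).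
  elim: s sP {IH} => [_|l s IHs lsP].
    by rewrite zprod0 harm1r u1 subrr; apply: conj_map_of1.
  have /andP[l1 sP] := lsP; rewrite zprod_cons; set w := zprod s in IHs *.
  have {}IHs := IHs sP.
  apply: etrans (congr1 (conj_map f) (esym (mulrA (X ^+ l.-1) Y
    (HH1_val w)))) _.
  apply: etrans (conj_map_Xn _ _ _) _.
  apply: etrans (congr1 (fun w : HH => X ^+ l.-1 * w) (conj_map_Y _ _)) _.
  apply: etrans (congr2 (fun a b : HH => X ^+ l.-1 * (Y * a - (X + Y) * b))
    IHs (A w)) _.
  apply: etrans (bridge_rearrange _ _ _ _ _) _; apply: esym.
  apply: etrans (congr1 (fun a : HH => a - HH1_val (harm_head u (z l * w)))
    (harm_zr u w l1)) _.
  apply: etrans (addrAC _ _ _) _.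
  apply: etrans (congr1 (fun a : HH => a + _) (subrr _)) _.
  apply: etrans (add0r _) _.
  apply: (congr2 (fun a b : HH => a + b)); first reflexivity.
  apply: (congr1 (fun a : HH => a * HH1_val (harm_head u w))).
  by rewrite -[l in LHS](prednK l1) exprSr.
apply: etrans (conj_mapZD _ _ _ _) _.
apply: etrans (congr2 (fun a b : HH => c *: a + b) e IH) _.
apply: etrans (lin_sub_rearrange _ _ _ _ _) _; apply: esym.
exact: (congr2 (fun a b : HH => a - b) (congr1 HH1_val (harmDr _ _ _ _))
  (congr1 HH1_val (harm_head_linr _ _ _ _))).
Qed.

(** Such a [u] is the element w_f with A_f = -N_u on H^1. *)
Definition is_symbol f u :=
  homog (deg f) u /\ (forall v, conj_phiRx f (HH1_val v) =
    - HH1_val (harm_head u v)).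

Lemma symbol_conj_map f u v : f != mone -> is_symbol f u ->
  conj_map f (HH1_val v) = HH1_val (harm u v) - HH1_val (harm_head u v).
Proof.
move=> f1 [uP uA]; apply: conj_map_HH1 => //.
by apply: harm_head_homog uP; rewrite lt0n deg_eq0.
Qed.

Lemma symbol_bullet : is_symbol (ucm bullet) (z 1).
Proof.
split=> [|v]; first by rewrite deg_Bplus deg1; apply: homog_z.
apply: etrans (conj_phiRx_Bplus _ _) _.
apply: etrans (congr2 (fun a b : HH => (X + Z) * a - Y * b)
  (conj_phiRx_mone _) (conj_map1 _)) _.
rewrite mulr0 sub0r; congr (- _).
have e : harm_head (z 1) v = z 1 * v.
  by rewrite -[z 1]mulr1 harm_head_z // harm1l mulr1.
apply: etrans _ (congr1 HH1_val (esym e)).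
by apply: (congr1 (fun a : HH => a * HH1_val v)); apply: (esym (mul1r _)).
Qed.

(** The element is (2x + y) u, because (x + z) N_u + y (H_u - N_u) = 2 x N_u + y H_u. *)
Lemma symbol_Bplus f u : f != mone -> is_symbol f u ->
  is_symbol (ucm (Bplus f)) (xshift u + xshift u + z 1 * u).
Proof.
move=> f1 fu; have [uP uA] := fu; split=> [|v].
  rewrite deg_Bplus; apply: homogD; last exact: (homogM (homog_z _) uP).
  by apply: homogD; apply: homog_xshift.
apply: etrans (conj_phiRx_Bplus _ _) _.
apply: etrans (congr2 (fun a b : HH => (X + Z) * a - Y * b)
  (uA v) (symbol_conj_map v f1 fu)) _.
apply: etrans (bplus_rearrange _ _ _ _) _.
apply: (congr1 (fun a : HH => - a)); apply: esym.
have e : harm_head (xshift u + xshift u + z 1 * u) v =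
    harm_head (xshift u) v + harm_head (xshift u) v + z 1 * harm u v.
  apply: etrans (harm_head_addl _ _ _) _.
  exact: (congr2 (fun a b : HH1 => a + b) (harm_head_addl _ _ _)
    (harm_head_z _ _ _)).
apply: etrans (congr1 HH1_val e) _.
apply: (congr2 (fun a b : HH => a + b)).
  exact: (congr2 (fun a b : HH => a + b) (harm_head_xshift u v)
    (harm_head_xshift u v)).
by apply: (congr1 (fun a : HH => a * HH1_val (harm u v))); apply: (mul1r _).
Qed.

(** The formula for A_(gh) turns into [harm_head_harm] once f' is replaced by H - N and A by -N for
    each factor. *)
Lemma symbol_mul g h u v : g != mone -> h != mone ->
  is_symbol g u -> is_symbol h v -> is_symbol (mmul g h) (harm u v).
Proof.
move=> g1 h1 gu hv; have [uP uA] := gu; have [vP vA] := hv; split=> [|w].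
  by rewrite degM; apply: homog_harm.
apply: etrans (conj_phiRx_mul _ _ _) _.
have e1 : conj_phiRx g (conj_map h (HH1_val w)) =
  - HH1_val (harm_head u (harm v w - harm_head v w)).
  apply: etrans (congr1 (conj_phiRx g) (symbol_conj_map w h1 hv)) _.
  apply: etrans (congr1 (conj_phiRx g) (esym (HH1_valB _ _))) _.
  exact: (uA (harm v w - harm_head v w)).
(* On H^1 the operator g' - A_g is H_u, and the argument lies in H^1. *)
have e2 : conj_map g (conj_phiRx h (HH1_val w)) -
    conj_phiRx g (conj_phiRx h (HH1_val w)) = - HH1_val (harm u (harm_head v w)).
  have -> : conj_phiRx h (HH1_val w) = HH1_val (- harm_head v w) := vA w.
  apply: etrans (congr2 (fun a b : HH => a - b)
    (symbol_conj_map _ g1 gu) (uA (- harm_head v w))) _.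
  rewrite opprK subrK.
  by have := harm_subr u 0 (harm_head v w); rewrite harm0r !sub0r => ->.
apply: etrans (congr2 (fun a b : HH => a + b) e1 e2) _.
apply: etrans (esym (opprD _ _)) _.
exact: (congr1 (fun a => - HH1_val a) (esym (harm_head_harm _ _ _))).
Qed.

Lemma symbol_exists f : f != mone -> exists u, is_symbol f u.
Proof.
elim/forest_ind: f => [|f IH _|f g IHf IHg fg1]; first by rewrite eqxx.
  have [->|f1] := eqVneq f mone; first by exists (z 1); apply: symbol_bullet.
  by have [u /(symbol_Bplus f1)] := IH f1;
    exists (xshift u + xshift u + z 1 * u).
have [f1|f1] := eqVneq f mone.
  by rewrite f1 mul1m in fg1 *; apply: IHg.
have [g1|g1] := eqVneq g mone.
  by rewrite g1 mulm1 in fg1 *; apply: IHf.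
have [u fu] := IHf f1; have [v gv] := IHg g1.
by exists (harm u v); apply: symbol_mul.
Qed.

End ForestMaps.

(** * Spans of operators and lambda *)

Lemma opspan_cons (S : op -> Prop) c A B : S A -> opspan S B ->
  opspan S (fun v => c *: A v + B v).
Proof.
move=> SA [m [d [C [SC e]]]].
exists m.+1, (oapp d c \o unlift ord0), (oapp C A \o unlift ord0); split.
  by move=> i /=; case: (unlift _ _).
move=> v /=; rewrite big_ord_recl /= unlift_none /= e; congr (_ + _).
by apply: eq_bigr => i _; rewrite liftK.
Qed.

Lemma opspan0 (S : op -> Prop) : opspan S (fun _ => 0).
Proof.
exists 0%N, (fun _ => 0), (fun _ _ => 0); split; first by case.
by move=> v; rewrite big_ord0.
Qed.

Lemma opspan_sub (S T : op -> Prop) A :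
  (forall B, S B -> T B) -> opspan S A -> opspan T A.
Proof.
move=> ST [m [c [B [SB e]]]]; exists m, c, B; split=> // i.
exact/ST/SB.
Qed.

(** An equality of functions, since [lambda] is not assumed to respect pointwise equality of
    operators. *)
Lemma harm_head0_fun : harm_head 0 = (fun _ => 0).
Proof. by apply: functional_extensionality => v; apply: harm_head0. Qed.

Lemma harm_head_cons_fun c k s u : all (leq 1) (k :: s) ->
  harm_head (c *: zprod (k :: s) + u) = (fun v => c *: LHop k (zprod s) v +
    harm_head u v).
Proof.
move=> sP; apply: functional_extensionality => v.
apply: etrans (harm_head_linl _ _ _ _) _.
by rewrite (harm_head_zprod v sP).
Qed.

Lemma harm_head_W' n u : (0 < n)%N -> homog n u -> W'_ n (harm_head u).
Proof.
move=> n0; move: u; apply: homog_ind => [|c s u sP sn _ IH].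
  by rewrite harm_head0_fun; apply: opspan0.
case: s sP sn => [_ e|k s ksP sn]; first by rewrite -e in n0.
have /andP[k1 sP] := ksP.
rewrite harm_head_cons_fun //; apply: opspan_cons IH; exists k, (zprod s).
by rewrite k1 -sn leq_addr addKn; split=> //; apply: homog_zprod.
Qed.

Lemma W'_homog_sub n A : W'_ n A -> W' A.
Proof.
by apply: opspan_sub => B [k [w [/andP[k1 _] _ ->]]]; exists k, w.
Qed.

Lemma lambda_harm_head lambda n u : is_lambda lambda -> (0 < n)%N ->
  homog n u -> lambda (harm_head u) =1 Hop u.
Proof.
move=> lP n0; move: u; apply: homog_ind => [v|c s u sP sn uP IH v].
  rewrite harm_head0_fun /Hop harm0l.
  (* Linearity with coefficient -1 gives that [lambda] of the zero operator is its own negative plus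
     itself, hence 0. *)
  have e : (fun _ : HH1 => 0 : HH1) = (fun _ => -1 *: 0 + 0).
    by apply: functional_extensionality => w; rewrite scaler0 addr0.
  apply: etrans (congr1 (fun A => lambda A v) e) _.
  apply: etrans (lambdaP lP (-1) (opspan0 _) (opspan0 _) v) _.
  by rewrite scaleN1r addNr.
case: s sP sn => [_ e|k s ksP sn]; first by rewrite -e in n0.
have /andP[k1 sP] := ksP.
rewrite harm_head_cons_fun //.
have kW : W' (LHop k (zprod s)).
  exists 1%N, (fun _ => 1), (fun _ => LHop k (zprod s)); split.
    by move=> _; exists k, (zprod s).
  by move=> w; rewrite big_ord1 scale1r.
apply: etrans (lambdaP lP c kW (W'_homog_sub (harm_head_W' n0 uP)) v) _.
rewrite IH (lambda_LHop lP k1 (val_zprod s)) /Hop zprod_cons.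
exact/esym/harmDl.
Qed.

Theorem theorem4p4 (Phi : forest -> {linear HH -> HH}) (lambda : op -> op)
    (PhiP : is_forest_maps Phi) (lambdaP : is_lambda lambda)
    (n : nat) (f : forest) (n_gt0 : (0 < n)%N) (deg_f : deg f = n) :
  exists A : op,
    [/\ restricts (fun w => phi (tau (phi_Rx (Phi f) (tau (phi w))))) A,
        W'_ n A,
        restricts (fun w => chi_inv (Phi f (chi w))) (fun v => - lambda A v)
      & W_ n (fun v => - lambda A v)].
Proof.
have f1 : f != mone by rewrite -deg_eq0 deg_f -lt0n.
have [u fu] := symbol_exists PhiP f1; have [uP uA] := fu.
rewrite deg_f in uP; have uN := homogN uP.
have lE := lambda_harm_head lambdaP n_gt0 uN.
(* A_f = -N_u is written as N of -u, so that [lambda] sends it to H of -u. *)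
exists (harm_head (- u)); split=> [v||v|].
- apply: etrans (congr1 HH1_val (harm_head_oppl u v)) _; exact: (esym (uA v)).
- exact: harm_head_W'.
- have e : - lambda (harm_head (- u)) v = harm u v.
    by rewrite lE /Hop harm_oppl opprK.
  apply: etrans (congr1 HH1_val e) _; apply: esym.
  apply: etrans (chi_inv_forest_map PhiP _ _) _.
  apply: etrans (congr2 (fun a b : HH => a - b)
    (symbol_conj_map PhiP v f1 fu) (uA v)) _.
  by rewrite opprK subrK.
exists 1%N, (fun _ => -1), (fun _ => Hop (- u)); split.
  by move=> _; exists (- u).
by move=> v; rewrite big_ord1 scaleN1r lE.
Qed.
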